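(* Let $p\in(1,\infty)$. For $b\in[0,1]$ let \[ R(p,b):=\big(b^{p-1}+(1-b)^{p-1}\big)\big(b^{\frac1{p-1}}+(1-b)^{\frac1{p-1}}\big)^{p-1}, \] and for $p\ne2$ let $b_p\in(0,\tfrac12)$ be the unique maximizer of $R(p,\cdot)$ over $[0,\tfrac12]$ (it exists and $\partial R(p,b)/\partial b>0$ on $(0,b_p)$, $<0$ on $(b_p,\tfrac12)$). For $b\in(0,1)$ let \[ t_b:=b-\frac{b^{1/(p-1)}}{b^{1/(p-1)}+(1-b)^{1/(p-1)}}. \] For $a,b\in(0,\infty)$ let $X_{a,b}$ denote a random variable with $\mathsf{P}(X_{a,b}=b)=\frac a{a+b}=1-\mathsf{P}(X_{a,b}=-a)$ (so $\mathsf{E}X_{a,b}=0$). Let $C_p$ denote the best (smallest) constant $C\in[0,\infty]$ such that $\mathsf{E}|X-\mathsf{E}X|^p\le C\,\mathsf{E}|X|^p$ for all real random variables $X$ with finite mean. Then: (i) $C_p=\sup_{b\in[0,1]}R(p,b)=\max_{b\in(0,1/2)}R(p,b)$, and for $p\ne2$ also $C_p=R(p,b_p)$; in particular $C_2=R(2,b)=1$ for all $b\in[0,1]$. Hence $\mathsf{E}|X-\mathsf{E}X|^p\le C_p\,\mathsf{E}|X|^p$ for every random variable $X$ with finite mean. (ii) For a random variable $X$ with finite mean, equality $\mathsf{E}|X-\mathsf{E}X|^p= C_p\,\mathsf{E}|X|^p$ holds if and only if one of the following holds: (a) $\mathsf{E}|X|^p=\infty$; (b) $p=2$, $\mathsf{E}X^2<\infty$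 and $\mathsf{E}X=0$; (c) $p\ne2$ and $X$ has the same distribution as $\lambda(X_{1-b_p,b_p}-t_{b_p})$ for some $\lambda\in\mathbb{R}$. (iii) If $q$ is defined by $\frac1p+\frac1q=1$, then $C_p^{1/\sqrt{p-1}}=C_q^{1/\sqrt{q-1}}$, and, for $p\ne2$, $b_p=b_q$. (iv) As $p\to\infty$, $C_p\sim \dfrac{2^p}{\sqrt{8ep}}$ (i.e. the ratio tends to $1$). (v) $C_p$ is strictly log-convex and hence continuous in $p\in(1,\infty)$; moreover $C_p$ decreases in $p\in(1,2]$ from $2$ to $1$ and increases in $p\in[2,\infty)$ from $1$ to $\infty$. (vi) Whenever $p$ is rational, the values $C_p$, $b_p$ and $t_{b_p}$ are algebraic numbers; in particular $C_3=\frac1{27}(17+7\sqrt7)=1.315\ldots$, $b_3=\frac12-\frac16\sqrt{1+2\sqrt7}=0.0819\ldots$, and $t_{b_3}=-\frac13\sqrt{\frac12(13\sqrt7-34)}=-0.148\ldots$.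
   Context: Equality in distribution of random variables means they have the same law. In (v), ''decreases from $2$ to $1$'' means $C_p\to2$ as $p\downarrow1$ and $C_2=1$; ''increases from $1$ to $\infty$'' means $C_p\to\infty$ as $p\to\infty$. *)

(* Defs.v *)
From HB Require Import structures.
From mathcomp Require Import all_boot all_order all_algebra.
From mathcomp Require Import all_classical all_reals all_analysis.
Set Implicit Arguments. Unset Strict Implicit. Unset Printing Implicit Defensive.
Import Order.TTheory GRing.Theory Num.Theory.
Import numFieldNormedType.Exports.
Local Open Scope classical_set_scope.
Local Open Scope ring_scope.

Section Defs.
Variable R : realType.

Definition Rpb (p b : R) : R :=
  (b `^ (p - 1) + (1 - b) `^ (p - 1)) *
  (b `^ (1 / (p - 1)) + (1 - b) `^ (1 / (p - 1))) `^ (p - 1).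

Definition bp (p : R) : R :=
  xget 0 [set b | 0 <= b <= 1/2 /\
                  forall b', 0 <= b' <= 1/2 -> Rpb p b' <= Rpb p b].

Definition tb (p b : R) : R :=
  b - b `^ (1 / (p - 1)) / (b `^ (1 / (p - 1)) + (1 - b) `^ (1 / (p - 1))).

Definition Cbest (p : R) : \bar R :=
  ereal_inf [set C : \bar R | (0 <= C)%E /\
    forall (d : measure_display) (T : measurableType d)
           (P : probability T R) (X : {RV P >-> R}),
      P.-integrable setT (EFin \o X) ->
      (\int[P]_x (`| X x - fine 'E_P[X] | `^ p)%:E
         <= C * \int[P]_x (`| X x | `^ p)%:E)%E].

(* "X has the same distribution as lam * (X_{a,b} - t)", where
   P(X_{a,b} = b) = a/(a+b) = 1 - P(X_{a,b} = -a); written out on measurable sets. *)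
Definition same_law_scaled_twopoint (d : measure_display) (T : measurableType d)
  (P : probability T R) (X : {RV P >-> R}) (a b lam t : R) : Prop :=
  forall A : set R, measurable A ->
    P (X @^-1` A) = (a / (a + b) * \1_A (lam * (b - t))
                    + b / (a + b) * \1_A (lam * (- a - t)))%:E.

Definition algebraic_num (x : R) : Prop :=
  exists Q : {poly rat}, Q != 0 /\ root (map_poly (ratr : rat -> R) Q) x.

End Defs.

(* Main.v *)
Require Import Defs.
From HB Require Import structures.
From mathcomp Require Import all_boot all_order all_algebra.
From mathcomp Require Import all_classical all_reals all_analysis.
From mathcomp Require Import measurable_realfun ring lra zify.
Set Implicit Arguments. Unset Strict Implicit. Unset Printing Implicit Defensive.
Import Order.TTheory GRing.Theory Num.Theory.
Import numFieldNormedType.Exports.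
Local Open Scope classical_set_scope.
Local Open Scope ring_scope.

(* Write [r = p - 1], [s = 1 / r], [Y = X - E X] and [t = - E X].

   Inequality. For a centred two-point law on [{b, - a}], Jensen's inequality
   for [x^p] gives [a b^p + b a^p <= R(p, b / (a + b)) (a |b - t|^p + b |a + t|^p)],
   with equality only for one [t]. Hence [g y = C |y - t|^p - |y|^p], with
   [C = max R(p, _)], satisfies [a g(b) + b g(- a) >= 0] for all [a, b > 0], that
   is [- g(- a) / a <= g(b) / b]; so some [k] has [g y >= k y] for all [y], and
   integrating over the law of [Y] gives the bound. In the equality case
   [g(Y) = k Y] almost surely, every pair of contact points is an equality case
   of the two-point inequality, and there is only one such pair.

   Maximizer. With [b = 1 / (1 + e^y)] one has [ln R = N(y) - r N(y / r)], where
   [N y = ln (1 + e^(- r y)) - ln (1 + e^(- y))]. For [r > 1] the derivative [K] of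
   [N] increases and then decreases, so [K y = K (y / r)] has at most one positive
   solution. The case [r < 1] follows from [R(q, b) = R(p, b)^(1 / (p - 1))] for
   conjugate exponents.

   Dependence on p. For fixed [b] in (0, 1/2), [ln R(p, b)] is a strictly
   convex log-sum-exp plus the perspective of one, so [ln C_p] is strictly
   convex; it is minimal at 2. For large [p] the maximum is located near
   [b = 1 / (2 r)], where [R] is close to [2^r (1 - b)^r sqrt b]. For rational [p]
   the critical equation is polynomial in a power of [b / (1 - b)]. *)

(** * Jensen inequalities for powers *)

(** The linear minorant [k y <= g y] takes the place of a decomposition of a centred law into
    two-point laws. It also shows that [|X - E X|^p] is integrable as soon as [|X|^p] is, and it
    turns equality of integrals into the pointwise condition [g Y = k Y], which leaves only finitely
    many contact points to identify.

    The exponent 2 stands apart: [R(2, b)] is constantly 1, so [bp 2] is an unspecified maximizer,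
    possibly an endpoint. Arguments covering [p = 2] therefore take an interior maximizer instead of
    [bp p].

    The substitution [b = 1 / (1 + e^y)] is chosen because the exponents [r] and [1 / r] then act
    only by rescaling [y]; both factors of [R] become values of one function.

    The constant [sqrt (8 e p)] comes from [sqrt b e^(- r b)], whose maximum, at [b = 1 / (2 r)], is
    [1 / sqrt (2 e r)]; and [2^r / sqrt (2 e r) = 2^p / sqrt (8 e r)]. *)

(** The tangent of [expR] at the weighted mean [m] of the logarithms bounds [A] and [B] strictly
    from below; in the weighted sum of the two bounds the linear terms cancel. *)
Lemma ltr_weighted_amgm (R : realType) (A B t : R) : 0 < A -> 0 < B -> A != B ->
  0 < t < 1 -> A `^ t * B `^ (1 - t) < t * A + (1 - t) * B.
Proof.
move=> A0 B0 AB /andP[t0 t1].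
have lnAB : ln A != ln B by apply: contra_neq AB; apply: ln_inj.
pose m := t * ln A + (1 - t) * ln B.
have -> : A `^ t * B `^ (1 - t) = expR m by rewrite /powR !gt_eqF// -expRD.
have key (C : R) : 0 < C -> ln C != m -> expR m * (1 + (ln C - m)) < C.
  move=> C0 Cm; rewrite -[ltRHS](lnK C0) -[X in _ < expR X](subrK m) (expRD (ln C - m)) mulrC.
  by rewrite ltr_pM2r ?expR_gt0// expR_gt1Dx// subr_eq0.
have dm : (1 - t) * (ln A - ln B) != 0 by rewrite mulf_neq0// ?subr_eq0// gt_eqF.
have dm' : t * (ln A - ln B) != 0 by rewrite mulf_neq0// ?subr_eq0// gt_eqF.
have hA := key A A0; have hB := key B B0.
have {}hA : expR m * (1 + (ln A - m)) < A.
  by apply: hA; rewrite -subr_eq0; apply: contra_neq dm => <-; rewrite /m; ring.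
have {}hB : expR m * (1 + (ln B - m)) < B.
  apply: hB; rewrite -subr_eq0; apply: contra_neq dm' => h.
  by rewrite -[RHS]oppr0 -h /m; ring.
have -> : expR m = t * (expR m * (1 + (ln A - m))) +
                   (1 - t) * (expR m * (1 + (ln B - m))) by rewrite /m; ring.
by rewrite ltrD// ltr_pM2l// subr_gt0.
Qed.

(** For [z > 0] this is the weighted AM-GM inequality for [z^p] and 1 with weight [1 / p]. *)
Lemma bernoulli_ltr_powR (R : realType) (p z : R) : 1 < p -> 0 <= z -> z != 1 ->
  1 + p * (z - 1) < z `^ p.
Proof.
move=> p1; rewrite le_eqVlt => /predU1P[<- _|z0 z1].
  by rewrite powR0 ?gt_eqF//; lra.
have p0 : 0 < p by lra.
have zp1 : z `^ p != 1.
  by rewrite powR_eq1 negb_or z1 negb_or -leNgt ltW//= gt_eqF.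
have /= := @ltr_weighted_amgm R (z `^ p) 1 p^-1 (powR_gt0 _ z0) ltr01 zp1.
rewrite powR1 mulr1 -powRrM mulfV ?gt_eqF// powRr1 ?ltW//.
rewrite invr_gt0 p0 invf_lt1//= => /(_ p1) h.
rewrite -(ltr_pM2l (_ : 0 < p^-1)) ?invr_gt0//.
have -> : p^-1 * (1 + p * (z - 1)) = p^-1 + z - 1 by field; rewrite gt_eqF.
by rewrite mulr1 in h; lra.
Qed.

Lemma tangent_ltr_powR (R : realType) (p m x : R) : 1 < p -> 0 < m -> 0 <= x ->
  x != m -> m `^ p + p * m `^ (p - 1) * (x - m) < x `^ p.
Proof.
move=> p1 m0 x0 xm; have mn0 : m != 0 by rewrite gt_eqF.
have z1 : x / m != 1 by apply: contra_neq xm => h; rewrite -(divfK mn0 x) h mul1r.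
have h := @bernoulli_ltr_powR R p (x / m) p1 (divr_ge0 x0 (ltW m0)) z1.
rewrite -[in ltRHS](divfK mn0 x) powRM ?divr_ge0// ?(ltW m0)//.
rewrite -(@mulr_powRB1 _ m) ?(ltW m0)//; last by lra.
have -> : m * m `^ (p - 1) + p * m `^ (p - 1) * (x - m) =
   (1 + p * (x / m - 1)) * (m * m `^ (p - 1)) by field.
by rewrite ltr_pM2r// mulr_gt0// powR_gt0.
Qed.

Lemma tangent_ler_powR (R : realType) (p m x : R) : 1 < p -> 0 < m -> 0 <= x ->
  m `^ p + p * m `^ (p - 1) * (x - m) <= x `^ p.
Proof.
move=> p1 m0 x0; have [->|xm] := eqVneq x m; first by rewrite subrr mulr0 addr0.
exact/ltW/tangent_ltr_powR.
Qed.

(** [u + v] is the mean of [u / w1] and [v / w2], so the tangent of [x^p] at [u + v] is averaged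
    over these two points; it is strict unless both equal the mean. *)
Lemma jensen_powR (R : realType) (p w1 w2 u v : R) : 1 < p ->
  0 < w1 -> 0 < w2 -> w1 + w2 = 1 -> 0 <= u -> 0 <= v ->
  (u + v) `^ p <= w1 * (u / w1) `^ p + w2 * (v / w2) `^ p ?= iff (u == w1 * (u + v)).
Proof.
move=> p1 w10 w20 w12 u0 v0; set m := u + v.
have p0 : p != 0 by rewrite gt_eqF//; lra.
have w1n : w1 != 0 by rewrite gt_eqF.
have w2n : w2 != 0 by rewrite gt_eqF.
have [m0|mpos] := leP m 0.
  have [u00 v00] : u = 0 /\ v = 0 by split; rewrite /m in m0; lra.
  rewrite /m u00 v00 !mul0r addr0 mulr0 !powR0// !mulr0 addr0.
  by split; rewrite ?lexx ?eqxx.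
have U0 : 0 <= u / w1 by rewrite divr_ge0// ltW.
have V0 : 0 <= v / w2 by rewrite divr_ge0// ltW.
have eqm : m `^ p = w1 * (m `^ p + p * m `^ (p - 1) * (u / w1 - m)) +
                    w2 * (m `^ p + p * m `^ (p - 1) * (v / w2 - m)).
  rewrite [RHS](_ : _ = (w1 + w2) * m `^ p + p * m `^ (p - 1) * (u + v - (w1 + w2) * m)).
    by rewrite w12 !mul1r -/m subrr mulr0 addr0.
  by field; rewrite w1n w2n.
have le1 : w1 * (m `^ p + p * m `^ (p - 1) * (u / w1 - m)) <= w1 * (u / w1) `^ p.
  by rewrite ler_pM2l//; apply: tangent_ler_powR.
have le2 : w2 * (m `^ p + p * m `^ (p - 1) * (v / w2 - m)) <= w2 * (v / w2) `^ p.
  by rewrite ler_pM2l//; apply: tangent_ler_powR.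
split; first by rewrite {1}eqm lerD.
apply/eqP/eqP => [h|h]; last first.
  have -> : v = w2 * m by rewrite (_ : w2 = 1 - w1) ?mulrBl -?h /m; lra.
  by rewrite h !(mulrAC _ m) !mulfV// !mul1r -mulrDl w12 mul1r.
apply/eqP; apply/negPn/negP => um.
have : w1 * (m `^ p + p * m `^ (p - 1) * (u / w1 - m)) < w1 * (u / w1) `^ p.
  rewrite ltr_pM2l//; apply: tangent_ltr_powR => //.
  by apply: contra_neq um => <-; rewrite mulrCA mulfV ?mulr1.
by move: h; rewrite {1}eqm; lra.
Qed.

(** * The optimal centre of a two-point law *)

Section two_point.
Variables (R : realType) (p : R).
Hypothesis p1 : 1 < p.

Lemma conj_expK (x : R) : 0 <= x -> (x `^ (1 / (p - 1))) `^ (p - 1) = x.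
Proof.
by move=> x0; rewrite -powRrM div1r mulVf ?powRr1// gt_eqF// subr_gt0.
Qed.

(* Jensen with weights proportional to
   [b `^ s] and [a `^ s], where [s = 1 / (p - 1)]. *)
Lemma two_point_center_ge (a b t : R) : 0 < a -> 0 < b ->
  let S := a `^ (1 / (p - 1)) + b `^ (1 / (p - 1)) in
  a * b * (a + b) `^ p <= S `^ (p - 1) * (a * `|b - t| `^ p + b * `|a + t| `^ p)
    ?= iff (t == b - (a + b) * (b `^ (1 / (p - 1)) / S)).
Proof.
move=> a0 b0; set s := 1 / (p - 1) => S.
have as0 : 0 < a `^ s by rewrite powR_gt0.
have bs0 : 0 < b `^ s by rewrite powR_gt0.
have S0 : 0 < S by rewrite addr_gt0.
have Sn : S != 0 by rewrite gt_eqF.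
have p10 : 0 < p - 1 by rewrite subr_gt0.
have p0 : 0 < p by lra.
pose w1 := b `^ s / S; pose w2 := a `^ s / S.
have w10 : 0 < w1 by rewrite divr_gt0.
have w20 : 0 < w2 by rewrite divr_gt0.
have w12 : w1 + w2 = 1 by rewrite -mulrDl addrC divff.
(* This identity explains the weights: [c^s] raised to the power [p - 1] is [c], so Jensen's
   right-hand side becomes a multiple of [a |b - t|^p + b |a + t|^p]. *)
have wp c x : 0 < c -> 0 <= x ->
    c `^ s / S * (x / (c `^ s / S)) `^ p = S `^ (p - 1) * (x `^ p / c).
  move=> c0 x0; have cs0 : 0 < c `^ s by rewrite powR_gt0.
  have -> : x / (c `^ s / S) = x * (S / c `^ s) by field; rewrite Sn gt_eqF.
  rewrite powRM// ?divr_ge0// ?ltW// -(@mulr_powRB1 _ (S / _))// ?divr_ge0// ?ltW//.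
  rewrite powRM ?invr_ge0 ?ltW// -[(c `^ s)^-1]powR_inv1 ?ltW//.
  rewrite (powRAC _ (-1)) conj_expK ?ltW// !powR_inv1 ?ltW//.
  by field; rewrite Sn !gt_eqF.
have := @jensen_powR R p w1 w2 `|b - t| `|a + t| p1 w10 w20 w12
  (normr_ge0 _) (normr_ge0 _).
rewrite /w1 /w2 !wp//.
have -> : S `^ (p - 1) * (`|b - t| `^ p / b) + S `^ (p - 1) * (`|a + t| `^ p / a)
   = (S `^ (p - 1) * (a * `|b - t| `^ p + b * `|a + t| `^ p)) / (a * b).
  by field; rewrite !gt_eqF.
set X := (S `^ (p - 1) * _); move=> [lej eqj].
have ab0 : 0 < a * b by rewrite mulr_gt0.
have lab : a + b <= `|b - t| + `|a + t|.
  rewrite (le_trans _ (ler_normD _ _))//.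
  by rewrite (_ : b - t + (a + t) = a + b) ?ler_norm//; ring.
have lep : (a + b) `^ p <= (`|b - t| + `|a + t|) `^ p.
  by apply: ge0_ler_powR; rewrite ?nnegrE ?(ltW p0)// ltW ?(lt_le_trans _ lab)// addr_gt0.
have le1 : a * b * (a + b) `^ p <= X.
  by rewrite mulrC -ler_pdivlMr//; exact: le_trans lep lej.
split=> //; apply/eqP/eqP => [h|tE]; last first.
  rewrite /X tE.
  have -> : b - (b - (a + b) * (b `^ s / S)) = (a + b) * w1 by rewrite /w1; ring.
  have -> : a + (b - (a + b) * (b `^ s / S)) = (a + b) * w2.
    by rewrite (_ : w2 = 1 - w1) -?/w1; [ring|lra].
  have abw w : 0 < w -> `|(a + b) * w| `^ p = (a + b) `^ p * (w * w `^ (p - 1)).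
    move=> w0; rewrite ger0_norm; last by rewrite mulr_ge0// ltW// addr_gt0.
    by rewrite powRM// ?ltW// ?addr_gt0// mulr_powRB1// ltW.
  rewrite !abw// {2}/w1 {2}/w2 !powRM ?invr_ge0 ?ltW// !conj_expK ?ltW//.
  rewrite -!powR_inv1 ?ltW// (powRAC _ (-1)) powR_inv1 ?powR_ge0//.
  rewrite [RHS](_ : _ = (w1 + w2) * (a * b * (a + b) `^ p)); first by rewrite w12 mul1r.
  by field; rewrite gt_eqF// powR_gt0.
have hx : X / (a * b) = (a + b) `^ p by rewrite -h; field; rewrite !gt_eqF.
(* Equality overall forces equality in the triangle inequality, which gives [t <= b], as well as in
   Jensen, which then fixes [b - t]. *)
have eab : `|b - t| + `|a + t| = a + b.
  apply: (@powR_injective _ p) => //; rewrite ?nnegrE.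
  - by rewrite addr_ge0.
  - by rewrite ltW// addr_gt0.
  - by apply/le_anti/andP; rewrite lep; split=> //; rewrite -hx.
have /eqP : `|b - t| == b `^ s / S * (`|b - t| + `|a + t|).
  by rewrite -eqj eab hx.
rewrite eab => e.
have tb : t <= b.
  have := ler_norm (a + t); have := ler_norm (t - b).
  by rewrite (distrC t); lra.
by rewrite ger0_norm ?subr_ge0// in e; lra.
Qed.

End two_point.

(** * The function R(p, b) *)

Section two_term_power_sum.
Variable R : realType.
Implicit Types b u v p t : R.

Definition powsum u b : R := b `^ u + (1 - b) `^ u.

Lemma RpbE p b : Rpb p b = powsum (p - 1) b * powsum (1 / (p - 1)) b `^ (p - 1).
Proof. by []. Qed.

Lemma powsum_gt0 u b : 0 <= b <= 1 -> 0 < powsum u b.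
Proof.
move=> /andP[]; rewrite le_eqVlt => /predU1P[<- _|b0 b1].
  by rewrite /powsum subr0 powR1 ltr_wpDl// powR_ge0.
by rewrite /powsum ltr_pwDl ?powR_ge0// powR_gt0.
Qed.

Lemma powsum_onem u b : powsum u (1 - b) = powsum u b.
Proof. by rewrite /powsum subKr addrC. Qed.

Lemma powR_le1 (x u : R) : 0 <= x <= 1 -> 0 <= u -> x `^ u <= 1.
Proof.
move=> /andP[x0 x1] u0; have := @ge0_ler_powR R u u0 x 1.
by rewrite powR1; apply; rewrite ?nnegrE.
Qed.

Lemma powR_mix u v t (c A B : R) : 0 < c -> 0 < A -> 0 < B ->
  (c `^ u / A) `^ t * (c `^ v / B) `^ (1 - t) =
  c `^ (t * u + (1 - t) * v) / (A `^ t * B `^ (1 - t)).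
Proof.
move=> c0 A0 B0; rewrite /powR !gt_eqF ?divr_gt0 ?expR_gt0//.
rewrite !ln_div ?posrE ?expR_gt0// !expRK -!expRD -expRN -expRD.
by congr expR; ring.
Qed.

(** This is Hölder's inequality: AM-GM is applied to each term divided by its sum, and the
    normalized terms add up to 1. The term in [b] is strict, since equality there would force
    [(b / (1 - b))^(u - v) = 1], that is [b = 1/2]. *)
Lemma ltr_ln_powsum b u v t : 0 < b < 1/2 -> u != v -> 0 < t < 1 ->
  ln (powsum (t * u + (1 - t) * v) b) <
  t * ln (powsum u b) + (1 - t) * ln (powsum v b).
Proof.
move=> /andP[b0 b12] uv t01.
have b1 : 0 < 1 - b by lra.
have bb : 0 <= b <= 1 by apply/andP; split; lra.
have su := powsum_gt0 u bb; have sv := powsum_gt0 v bb.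
have sw := powsum_gt0 (t * u + (1 - t) * v) bb.
have fctr (c : R) (c0 : 0 < c) := powR_mix u v t c0 su sv.
have neq : b `^ u / powsum u b != (b `^ v / powsum v b).
  apply/eqP => /eqP; rewrite eqr_div ?(gt_eqF su) ?(gt_eqF sv)// /powsum !mulrDr => /eqP h.
  have {}h : b `^ u * (1 - b) `^ v = b `^ v * (1 - b) `^ u by lra.
  have := congr1 (@ln R) h.
  rewrite !lnM ?posrE ?powR_gt0// !ln_powR => {}h.
  have {}h : (u - v) * (ln b - ln (1 - b)) = 0 by lra.
  have /eqP := h; rewrite mulf_eq0 !subr_eq0 (negbTE uv)/= => /eqP/ln_inj.
  by rewrite !posrE => /(_ b0 b1); lra.
have d0 c w : 0 < c -> 0 < c `^ w / powsum w b.
  by move=> c0; rewrite divr_gt0 ?powR_gt0// powsum_gt0.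
have ltb := ltr_weighted_amgm (d0 b u b0) (d0 b v b0) neq t01.
have leb : ((1 - b) `^ u / powsum u b) `^ t * ((1 - b) `^ v / powsum v b) `^ (1 - t)
   <= t * ((1 - b) `^ u / powsum u b) + (1 - t) * ((1 - b) `^ v / powsum v b).
  have [->|ne] := eqVneq ((1 - b) `^ u / powsum u b) ((1 - b) `^ v / powsum v b).
    rewrite -powRD; last by rewrite [t + _]addrC subrK oner_eq0.
    by rewrite -mulrDl [t + _]addrC subrK mul1r powRr1 ?lexx// ltW// d0.
  exact/ltW/(ltr_weighted_amgm (d0 _ u b1) (d0 _ v b1) ne t01).
rewrite (fctr _ b0) in ltb; rewrite (fctr _ b1) in leb.
have tot : t * (b `^ u / powsum u b) + (1 - t) * (b `^ v / powsum v b) +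
   (t * ((1 - b) `^ u / powsum u b) + (1 - t) * ((1 - b) `^ v / powsum v b)) = 1.
  rewrite [LHS](_ : _ = t * (powsum u b / powsum u b) + (1 - t) * (powsum v b / powsum v b)).
    by rewrite !divff ?gt_eqF//; ring.
  by rewrite /powsum; ring.
have := ltr_leD ltb leb; rewrite tot -mulrDl.
rewrite ltr_pdivrMr ?mul1r; last by rewrite mulr_gt0 ?powR_gt0.
rewrite -[in X in X -> _]ltr_ln ?posrE//; last by rewrite mulr_gt0 ?powR_gt0.
rewrite -> (lnM (powR_gt0 t su) (powR_gt0 (1 - t) sv)), (ln_powR _ t).
by rewrite -> ln_powR.
Qed.

Lemma Rpb_gt0 p b : 0 <= b <= 1 -> 0 < Rpb p b.
Proof. by move=> b01; rewrite RpbE mulr_gt0 ?powR_gt0 ?powsum_gt0. Qed.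

Lemma ln_Rpb p b : 0 <= b <= 1 ->
  ln (Rpb p b) = ln (powsum (p - 1) b) + (p - 1) * ln (powsum (1 / (p - 1)) b).
Proof.
by move=> b01; rewrite RpbE lnM ?posrE ?powR_gt0 ?powsum_gt0// ln_powR.
Qed.

Lemma Rpb_onem p b : Rpb p (1 - b) = Rpb p b.
Proof. by rewrite !RpbE !powsum_onem. Qed.

Lemma Rpb0 p : 1 < p -> Rpb p 0 = 1.
Proof.
move=> p1; have h : p - 1 != 0 by rewrite gt_eqF// subr_gt0.
by rewrite /Rpb subr0 !powR1 !powR0// ?add0r ?powR1 ?mulr1// mulf_neq0 ?invr_eq0 ?oner_eq0.
Qed.

Lemma Rpb_half p : 1 < p -> Rpb p (1/2) = 1.
Proof.
move=> p1; have h : p - 1 != 0 by rewrite gt_eqF// subr_gt0.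
have h2 : 0 <= 1/2 :> R by lra.
rewrite /Rpb (_ : 1 - 1/2 = 1/2 :> R); last by lra.
have dbl (x : R) : x + x = 2 * x by ring.
rewrite !dbl powRM ?powR_ge0// conj_expK//.
rewrite [LHS](_ : _ = 2 `^ (p - 1) * (1/2) `^ (p - 1)); last by field.
by rewrite -powRM// (_ : 2 * (1/2) = 1 :> R) ?powR1//; lra.
Qed.

Lemma Rpb2 b : 0 <= b <= 1 -> Rpb 2 b = 1.
Proof.
move=> /andP[b0 b1]; rewrite /Rpb (_ : 2 - 1 = 1); last by lra.
rewrite divr1 (powRr1 b0) (@powRr1 _ (1 - b)) ?subr_ge0//.
by rewrite (_ : b + (1 - b) = 1) ?powRr1 ?mulr1//; ring.
Qed.

Lemma conj_gt1 p : 1 < p -> 1 < p / (p - 1).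
Proof. by move=> p1; rewrite ltr_pdivlMr ?subr_gt0// mul1r; lra. Qed.

Lemma conj_subr1 p : 1 < p -> p / (p - 1) - 1 = 1 / (p - 1).
Proof. by move=> p1; field; rewrite gt_eqF// subr_gt0. Qed.

Lemma Rpb_conj p b : 1 < p -> 0 <= b <= 1 ->
  Rpb (p / (p - 1)) b = Rpb p b `^ (1 / (p - 1)).
Proof.
move=> p1 b01; have p10 : p - 1 != 0 by rewrite gt_eqF// subr_gt0.
rewrite RpbE (RpbE p) conj_subr1// powRM ?powR_ge0 ?ltW ?powsum_gt0//.
rewrite -powRrM (_ : (p - 1) * (1 / (p - 1)) = 1); last by field.
rewrite powRr1 ?ltW ?powsum_gt0// mulrC.
by rewrite (_ : 1 / (1 / (p - 1)) = p - 1)//; field.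
Qed.

Lemma ltr_ln_Rpb b p q t : 1 < p -> 1 < q -> p != q -> 0 < t < 1 -> 0 < b < 1/2 ->
  ln (Rpb (t * p + (1 - t) * q) b) < t * ln (Rpb p b) + (1 - t) * ln (Rpb q b).
Proof.
move=> p1 q1 pq /andP[t0 t1] b12; case/andP: (b12) => b0 b1.
have b01 : 0 <= b <= 1 by apply/andP; split; lra.
rewrite -> (ln_Rpb (t * p + (1 - t) * q) b01), (ln_Rpb p b01), (ln_Rpb q b01).
set w := t * p + (1 - t) * q - 1.
have t1' : 0 < 1 - t by lra.
have p1' : 0 < p - 1 by lra.
have q1' : 0 < q - 1 by lra.
have wE : w = t * (p - 1) + (1 - t) * (q - 1) by rewrite /w; ring.
have wtp : 0 < t * (p - 1) by rewrite mulr_gt0.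
have wtq : 0 < (1 - t) * (q - 1) by rewrite mulr_gt0.
have w0 : 0 < w by lra.
have h1 : ln (powsum w b) <
    t * ln (powsum (p - 1) b) + (1 - t) * ln (powsum (q - 1) b).
  rewrite wE; apply: ltr_ln_powsum => //; last by rewrite t0.
  by apply: contra_neq pq; lra.
(* Perspective: [1 / w] is the average of [1 / (p - 1)] and [1 / (q - 1)] with weights
   [t (p - 1) / w] and [(1 - t) (q - 1) / w]; multiplying by [w] restores the weights [t] and
   [1 - t]. *)
have h2 : ln (powsum (1 / w) b) < t * (p - 1) / w * ln (powsum (1 / (p - 1)) b) +
     (1 - t * (p - 1) / w) * ln (powsum (1 / (q - 1)) b).
  have -> : 1 / w = t * (p - 1) / w * (1 / (p - 1)) +
     (1 - t * (p - 1) / w) * (1 / (q - 1)).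
    rewrite (_ : 1 - _ = (1 - t) * (q - 1) / w); first by field; rewrite !gt_eqF.
    by rewrite -[X in X - _](@divff _ w) ?gt_eqF// -mulrBl {1}wE; congr (_ / _); ring.
  apply: ltr_ln_powsum => //.
    by rewrite !div1r; apply: contra_neq pq => /invr_inj; lra.
  by rewrite divr_gt0// ltr_pdivrMr// mul1r wE ltrDl.
have {}h2 : w * ln (powsum (1 / w) b) < t * ((p - 1) * ln (powsum (1 / (p - 1)) b)) +
     (1 - t) * ((q - 1) * ln (powsum (1 / (q - 1)) b)).
  rewrite -(ltr_pM2l w0) in h2; apply: (lt_le_trans h2).
  rewrite le_eqVlt; apply/orP; left; apply/eqP.
  set x := ln (powsum (1 / (p - 1)) b); set y := ln (powsum (1 / (q - 1)) b).
  transitivity (t * (p - 1) * x + (w - t * (p - 1)) * y); first by field; rewrite gt_eqF.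
  by rewrite wE; ring.
by lra.
Qed.

(* [ln R] is convex in [p], vanishes at 2 and has the same sign at p and at its
   conjugate exponent, which lies on the other side of 2. *)
Lemma Rpb_gt1 p b : 1 < p -> p != 2 -> 0 < b < 1/2 -> 1 < Rpb p b.
Proof.
move=> p1 p2 b12; case/andP: (b12) => b0 b1.
have b01 : 0 <= b <= 1 by apply/andP; split; lra.
have p10 : 0 < p - 1 by lra.
have p0 : 0 < p by lra.
set q := p / (p - 1); have q1 : 1 < q by exact: conj_gt1.
have pE : p - 1 != 1 by apply: contra_neq p2; lra.
have qE : q - 1 = 1 / (p - 1) by exact: conj_subr1.
have pq : p != q.
  rewrite -subr_eq0 (_ : p - q = p * (p - 2) / (p - 1)).
    by rewrite !mulf_neq0 ?invr_eq0 ?(gt_eqF p0) ?(gt_eqF p10) ?subr_eq0.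
  by rewrite /q; field; rewrite gt_eqF.
(* As [1 - 1 / p = 1 / q], this weight puts 2 between [p] and [q]: [(1 / p) p + (1 / q) q = 2]. *)
pose t := 1 / p.
have t01 : 0 < t < 1 by rewrite /t divr_gt0//= ltr_pdivrMr// mul1r.
have := @ltr_ln_Rpb b p q t p1 q1 pq t01 b12.
have -> : t * p + (1 - t) * q = 2 by rewrite /t /q; field; rewrite !gt_eqF.
rewrite Rpb2// ln1 Rpb_conj// ln_powR.
set L := ln (Rpb p b) => h.
have {}h : 0 < (t + (1 - t) / (p - 1)) * L by rewrite [ltRHS](_ : _ = t * L + (1 - t) * (1 / (p - 1) * L)) //; ring.
have L0 : 0 < L.
  rewrite pmulr_rgt0 // in h; case/andP: t01 => t0 t1.
  by rewrite addr_gt0// divr_gt0// subr_gt0.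
by rewrite -ltr_ln ?posrE ?Rpb_gt0// ln1.
Qed.

Lemma Rpb_ge1 p b : 1 < p -> 0 <= b <= 1 -> 1 <= Rpb p b.
Proof.
move=> p1 b01.
wlog b12 : b b01 / b <= 1/2.
  move=> wl; have [/wl|h] := leP b (1/2); first exact.
  by rewrite -Rpb_onem; apply: wl; [case/andP: b01 => ? ?; apply/andP; split|]; lra.
have [->|p2] := eqVneq p 2; first by rewrite Rpb2.
have [->|b0] := eqVneq b 0; first by rewrite Rpb0.
have [->|b2] := eqVneq b (1/2); first by rewrite Rpb_half.
by apply/ltW/Rpb_gt1 => //; rewrite !lt_neqAle b2 b12 eq_sym b0; case/andP: b01 => ->.
Qed.

Lemma continuous_powR_base u b : 0 < b -> {for b, continuous (fun x : R => x `^ u)}.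
Proof.
move=> b0; apply: differentiable_continuous; apply/derivable1_diffP.
by apply: derivable_powR; rewrite in_itv/= b0.
Qed.

Lemma continuous_Rpb p b : 0 < b < 1 -> {for b, continuous (Rpb p)}.
Proof.
move=> /andP[b0 b1].
have cps u : powsum u x @[x --> b] --> powsum u b.
  apply: cvgD; first exact: continuous_powR_base.
  apply: (@continuous_comp _ _ _ (fun x : R => 1 - x) (fun x : R => x `^ u)).
    by apply: continuousB; [exact: cst_continuous|exact: cvg_id].
  by apply: continuous_powR_base; rewrite subr_gt0.
apply: continuousM; first exact: cps.
apply: (@continuous_comp _ _ _ (powsum (1 / (p - 1))) (fun x : R => x `^ (p - 1))).
  exact: cps.
by apply: continuous_powR_base; apply: powsum_gt0; rewrite !ltW.
Qed.

(** The function majorizes [R(p, b)] for small [b], because [(1 - b)^u <= 1]. Its limit 1 keeps the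
    maximizer away from 0. *)
Lemma cvg_Rpb_bound p : 1 < p ->
  (1 + b `^ (p - 1)) * (1 + b `^ (1 / (p - 1))) `^ (p - 1) @[b --> 0^'+] --> (1 : R).
Proof.
move=> p1; have p10 : 0 < p - 1 by lra.
have c u : 0 < u -> 1 + b `^ u @[b --> 0^'+] --> (1 : R).
  by move=> u0; rewrite -[X in _ --> X]addr0; apply: cvgD; [exact: cvg_cst|exact: powR_cvg0].
rewrite -[X in _ --> X]mulr1; apply: cvgM; first exact: c.
have cvg1 := c (1 / (p - 1)) (divr_gt0 ltr01 p10).
have := continuous_cvg _ (@continuous_powR_base (p - 1) 1 ltr01) cvg1.
by rewrite powR1; apply.
Qed.

Lemma Rpb_max_exists p : 1 < p -> exists2 b, 0 < b < 1/2 &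
  forall b', 0 <= b' <= 1 -> Rpb p b' <= Rpb p b.
Proof.
move=> p1; have p10 : 0 < p - 1 by lra.
have [->|p2] := eqVneq p 2.
  exists (1/4); first by apply/andP; split; lra.
  by move=> b' b01; rewrite !Rpb2//; apply/andP; split; lra.
have q12 : 0 < (1/4 : R) < 1/2 by apply/andP; split; lra.
have rho1 := Rpb_gt1 p1 p2 q12.
have : \forall b \near 0^'+,
    (1 + b `^ (p - 1)) * (1 + b `^ (1 / (p - 1))) `^ (p - 1) < Rpb p (1/4).
  by apply: cvgr_lt; [exact: cvg_Rpb_bound|].
case=> e /= e0 he.
(* On [[0, eps]] the value stays below [R(p, 1/4) > 1], so the maximum over the compact interval
   [[eps, 1/2]] is global; it is not at [1/2], where [R = 1]. *)
pose eps : R := Num.min (e / 2) (1/4).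
have eps0 : 0 < eps by rewrite lt_min; apply/andP; split; lra.
have epse : eps < e by rewrite gt_min; apply/orP; left; lra.
have eps4 : eps <= 1/4 by rewrite ge_min lexx orbT.
have small b : 0 <= b <= eps -> Rpb p b < Rpb p (1/4).
  move=> /andP[]; rewrite le_eqVlt => /predU1P[<- _|b0 be]; first by rewrite Rpb0.
  have h : (1 + b `^ (p - 1)) * (1 + b `^ (1 / (p - 1))) `^ (p - 1) < Rpb p (1/4).
    by apply: he => //; rewrite /ball_/= sub0r normrN gtr0_norm//; lra.
  apply: le_lt_trans h.
  have b1 : 0 < 1 - b <= 1 by apply/andP; split; lra.
  have b1p u : 0 < u -> (1 - b) `^ u <= 1.
    by move=> u0; apply: powR_le1; [apply/andP; split; lra|exact: ltW].
  have s0 : 0 < 1 / (p - 1) by rewrite divr_gt0.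
  have B0 : 0 <= b <= 1 by apply/andP; split; lra.
  rewrite RpbE; apply: ler_pM; [exact/ltW/powsum_gt0|exact: powR_ge0| |].
    by rewrite /powsum addrC lerD2r b1p.
  apply: ge0_ler_powR; [exact: ltW|exact/ltW/powsum_gt0| |].
    by rewrite nnegrE addr_ge0// powR_ge0.
  by rewrite /powsum addrC lerD2r b1p.
have eh : eps <= 1/2 by lra.
have [|c cI cmax] := @EVT_max R (Rpb p) eps (1/2) eh.
  apply: continuous_in_subspaceT => x; rewrite inE/= in_itv/= => /andP[x1 x2].
  by apply: continuous_Rpb; apply/andP; split; lra.
move: cI; rewrite in_itv/= => /andP[c1 c2].
have cq : Rpb p (1/4) <= Rpb p c by apply: cmax; rewrite in_itv/= eps4; lra.
have c12 : c != 1/2 by apply/eqP => cE; move: cq rho1; rewrite cE Rpb_half//; lra.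
have all b' : 0 <= b' <= 1/2 -> Rpb p b' <= Rpb p c.
  move=> /andP[b0 b1]; have [be|be] := leP b' eps.
    by apply: le_trans cq; apply/ltW/small; rewrite b0.
  by apply: cmax; rewrite in_itv/= (ltW be).
exists c.
  by rewrite (lt_le_trans eps0 c1)/= lt_neqAle c12.
move=> b' /andP[b0 b1]; have [h|h] := leP b' (1/2); first by apply: all; rewrite b0.
have bb : 0 <= 1 - b' <= 1/2 by clear - b1 h; apply/andP; split; lra.
by have := all _ bb; rewrite Rpb_onem.
Qed.

End two_term_power_sum.

(** * Uniqueness of the maximizer *)

Section unimodality.
Variable R : realType.
Implicit Types r x y z b p : R.

(* The derivative of [ln (1 + e^(- r y)) - ln (1 + e^(- y))]. *)
Definition logistic_gap r y : R := (1 + expR y)^-1 - r * (1 + expR (r * y))^-1.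

Lemma is_derive_expRM r y : is_derive y 1 (fun x => expR (r * x)) (r * expR (r * y)).
Proof.
have h : is_derive y 1 (fun x : R => r * x) r.
  by apply: is_derive_eq; rewrite -[LHS]/(r *: 1) /GRing.scale/= mulr1.
rewrite mulrC; exact: (@is_derive1_comp R expR (fun x => r * x) y _ _ _ h).
Qed.

Lemma is_derive_logistic r y :
  is_derive y 1 (fun x => (1 + expR (r * x))^-1)
    (- (r * expR (r * y) / (1 + expR (r * y)) ^+ 2)).
Proof.
have h := is_derive_expRM r y.
have h1 : is_derive y 1 (fun x => 1 + expR (r * x)) (r * expR (r * y)).
  by rewrite -[X in is_derive _ _ _ X]add0r; apply: is_deriveD.
have n0 : 1 + expR (r * y) != 0 by rewrite gt_eqF// addr_gt0// expR_gt0.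
have h2 := @is_deriveV R _ y _ 1 n0 h1.
apply: (is_derive_eq h2).
by rewrite /GRing.scale/= mulNr mulrC.
Qed.

Lemma is_derive_softplus r y :
  is_derive y 1 (fun x => ln (1 + expR (- (r * x)))) (- (r * (1 + expR (r * y))^-1)).
Proof.
have h := is_derive_expRM (- r) y.
have h1 : is_derive y 1 (fun x => 1 + expR ((- r) * x)) ((- r) * expR ((- r) * y)).
  by rewrite -[X in is_derive _ _ _ X]add0r; apply: is_deriveD.
have n0 : 0 < 1 + expR ((- r) * y) by rewrite addr_gt0// expR_gt0.
have -> : (fun x => ln (1 + expR (- (r * x)))) = @ln R \o (fun x => 1 + expR ((- r) * x)).
  by apply/funext => x /=; rewrite mulNr.
apply: is_derive_eq; first exact: (@is_derive1_comp R (@ln R) _ y _ _ (is_derive1_ln n0) h1).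
rewrite mulNr expRN; field.
by rewrite !gt_eqF// ?expR_gt0// addr_gt0// ?expR_gt0.
Qed.

Lemma lt_of_is_derive (f df : R -> R) (a b : R) : a < b ->
  (forall x, is_derive x 1 f (df x)) -> (forall x, a < x < b -> 0 < df x) -> f a < f b.
Proof.
move=> ab dfE dfp.
have cf : {within `[a, b], continuous f}.
  apply: continuous_subspaceT => x; apply: differentiable_continuous.
  by apply/derivable1_diffP; have := dfE x; case.
have [c] := @MVT R f df a b ab (fun x _ => dfE x) cf.
by rewrite in_itv/= => /dfp c0 e; rewrite -subr_gt0 e mulr_gt0// subr_gt0.
Qed.

(** * The derivative of [N] rises and then falls *)

Section gap.
Variable r : R.
Hypothesis r1 : 1 < r.

(* [logistic_gap] increases where [r cosh (y/2) > cosh (r y/2)]. *)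
Definition cosh_gap y : R :=
  expR (r * (y / 2)) + expR (- (r * (y / 2))) - r * (expR (y / 2) + expR (- (y / 2))).

Lemma is_derive_logistic_gap y : is_derive y 1 (logistic_gap r)
  (r ^+ 2 * (expR (r * y) / (1 + expR (r * y)) ^+ 2) -
   expR y / (1 + expR y) ^+ 2).
Proof.
have h1 := is_derive_logistic 1 y; have h2 := is_derive_logistic r y.
have -> : logistic_gap r = (fun x => (1 + expR (1 * x))^-1) - r \*: (fun x => (1 + expR (r * x))^-1).
  by apply/funext => x /=; rewrite /logistic_gap !fctE mul1r.
apply: is_derive_eq; rewrite /GRing.scale/= !mul1r; ring.
Qed.

(** Written as [1 / (2 cosh (y/2))^2], the logistic density makes the derivative of [logistic_gap] a
    difference of squares, with the sign of a difference of first powers. *)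
Lemma sq_logistic_density y z : z = expR (y / 2) ->
  expR y / (1 + expR y) ^+ 2 = ((z + z^-1) ^+ 2)^-1.
Proof.
move=> zE; have z0 : 0 < z by rewrite zE expR_gt0.
have -> : expR y = z ^+ 2.
  by rewrite zE expr2 -expRD; congr expR; field.
have z2 : 0 < z ^+ 2 by rewrite exprn_gt0.
by field; rewrite (gt_eqF z0) !gt_eqF//; lra.
Qed.

Lemma logistic_gap_derive_sign y :
  (0 < r ^+ 2 * (expR (r * y) / (1 + expR (r * y)) ^+ 2) -
   expR y / (1 + expR y) ^+ 2) = (cosh_gap y < 0) /\
  (r ^+ 2 * (expR (r * y) / (1 + expR (r * y)) ^+ 2) -
   expR y / (1 + expR y) ^+ 2 < 0) = (0 < cosh_gap y).
Proof.
have r0 : 0 < r := lt_trans ltr01 r1.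
rewrite (@sq_logistic_density (r * y) (expR (r * (y / 2)))); last by rewrite mulrA.
rewrite (@sq_logistic_density y (expR (y / 2)))//.
rewrite /cosh_gap !expRN.
set A := expR (r * (y / 2)) + _; set B := expR (y / 2) + _.
have A0 : 0 < A by rewrite addr_gt0 ?invr_gt0 ?expR_gt0.
have B0 : 0 < B by rewrite addr_gt0 ?invr_gt0 ?expR_gt0.
have -> : r ^+ 2 * (A ^+ 2)^-1 - (B ^+ 2)^-1 =
   - (A - r * B) * ((A + r * B) / (A * B) ^+ 2).
  by field; rewrite !gt_eqF.
have P0 : 0 < (A + r * B) / (A * B) ^+ 2.
  rewrite divr_gt0//; first by apply: addr_gt0 => //; exact: mulr_gt0.
  by apply: exprn_gt0; exact: mulr_gt0.
by rewrite (pmulr_lgt0 _ P0) (pmulr_llt0 _ P0) oppr_gt0 oppr_lt0.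
Qed.

(** The derivative is [r (sinh (r z / 2) - sinh (z / 2))], positive for [z > 0] because [r > 1]. *)
Lemma cosh_gap_lt x y : 0 <= x -> x < y -> cosh_gap x < cosh_gap y.
Proof.
move=> x0 xy.
pose df (z : R) := r / 2 * expR (r / 2 * z) + (- (r / 2)) * expR (- (r / 2) * z)
   - r * (2^-1 * expR (2^-1 * z) + (- 2^-1) * expR (- 2^-1 * z)).
apply: (@lt_of_is_derive cosh_gap df) => //.
  move=> z.
  have h1 := is_derive_expRM (r / 2) z; have h2 := is_derive_expRM (- (r / 2)) z.
  have h3 := is_derive_expRM (2^-1) z; have h4 := is_derive_expRM (- 2^-1) z.
  have -> : cosh_gap = (fun x => expR (r / 2 * x)) + (fun x => expR (- (r / 2) * x))
     - r \*: ((fun x => expR (2^-1 * x)) + (fun x => expR (- 2^-1 * x))).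
    apply/funext => w; rewrite /cosh_gap !fctE /= /GRing.scale/=.
    have e1 : r * (w / 2) = r / 2 * w by field.
    have e2 : w / 2 = 2^-1 * w by ring.
    by rewrite e1 e2 !mulNr.
  by apply: is_derive_eq; rewrite /df /GRing.scale/=.
move=> z /andP[xz zy]; have z0 : 0 < z by apply: le_lt_trans xz.
rewrite /df.
rewrite !mulNr !expRN.
set A := expR (r / 2 * z); set B := expR (2^-1 * z).
have AB : B < A.
  by rewrite ltr_expR -subr_gt0 (_ : _ - _ = 2^-1 * z * (r - 1)) ?mulr_gt0 ?subr_gt0//; field.
have B1 : 1 < B by rewrite expR_gt1 mulr_gt0.
have A1 : 1 < A by apply: lt_trans AB.
have -> : r / 2 * A - r / 2 * A^-1 - r * (2^-1 * B - 2^-1 * B^-1) =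
   r / 2 * ((A - B) * (1 + (A * B)^-1)).
  by field; rewrite !gt_eqF//; apply: lt_trans ltr01 _.
have AB0 : 0 < A * B by rewrite mulr_gt0//; apply: lt_trans ltr01 _.
by rewrite !mulr_gt0 ?subr_gt0 ?addr_gt0 ?invr_gt0//; exact: lt_trans ltr01 r1.
Qed.

Lemma cosh_gap0 : cosh_gap 0 < 0.
Proof.
rewrite /cosh_gap mul0r mulr0 oppr0 expR0.
by rewrite (_ : _ - _ = 2 * (1 - r)); [rewrite pmulr_rlt0// subr_lt0|ring].
Qed.

Lemma cosh_gap_pos : exists2 y, 0 < y & 0 < cosh_gap y.
Proof.
have r0 : 0 < r := lt_trans ltr01 r1.
(* Chosen so that [(r - 1) y / 2 = 2 r]; then [e^(2 r) > 2 r] makes the term [e^(r y / 2)]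
   dominate. *)
pose y := 2 * (2 * r / (r - 1)); have y0 : 0 < y.
  by rewrite !mulr_gt0// ?invr_gt0 ?subr_gt0.
exists y => //; rewrite /cosh_gap.
have e1 : expR (- (y / 2)) < expR (y / 2) by rewrite ltr_expR; lra.
have e2 : 0 < expR (- (r * (y / 2))) by exact: expR_gt0.
have e3 : 2 * r * expR (y / 2) < expR (r * (y / 2)).
  have -> : r * (y / 2) = (r - 1) * (y / 2) + y / 2 by ring.
  rewrite expRD ltr_pM2r ?expR_gt0//.
  have -> : (r - 1) * (y / 2) = 2 * r by rewrite /y; field; rewrite gt_eqF// subr_gt0.
  by apply: lt_le_trans (expR_ge1Dx _); lra.
have e4 : r * expR (- (y / 2)) < r * expR (y / 2) by rewrite ltr_pM2l.
by lra.
Qed.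

(** The peak [c] is a zero of [cosh_gap], which is negative at 0 and increasing; the derivative of
    [logistic_gap] has the opposite sign. *)
Lemma logistic_gap_unimodal : exists2 c, 0 < c &
  (forall x y, 0 <= x -> x < y -> y <= c -> logistic_gap r x < logistic_gap r y) /\
  (forall x y, c <= x -> x < y -> logistic_gap r y < logistic_gap r x).
Proof.
have [y1 y10 y1p] := cosh_gap_pos.
have [c cI c0] : exists2 c, c \in `[0, y1] & cosh_gap c = 0.
  apply: IVT; first exact: ltW.
    apply: continuous_subspaceT => x.
    rewrite /cosh_gap.
    have cc (k : R) : {for x, continuous (fun z => expR (k * z))}.
      apply: differentiable_continuous; apply/derivable1_diffP.
      by have := is_derive_expRM k x; case.
    have -> : (fun y => expR (r * (y / 2)) + expR (- (r * (y / 2))) -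
       r * (expR (y / 2) + expR (- (y / 2)))) =
       (fun y => expR (r / 2 * y) + expR (- (r / 2) * y) - r * (expR (2^-1 * y) + expR (- 2^-1 * y))).
      apply/funext => w.
      have e1 : r * (w / 2) = r / 2 * w by field.
      have e2 : w / 2 = 2^-1 * w by ring.
      by rewrite e1 e2 !mulNr.
    apply: cvgB; first by apply: cvgD; exact: cc.
    by apply: cvgMr; apply: cvgD; exact: cc.
  by rewrite ge_min (ltW cosh_gap0) le_max (ltW y1p) orbT.
move: cI; rewrite in_itv/= => /andP[c_ge0 _].
have cpos : 0 < c.
  rewrite lt_neqAle c_ge0 andbT; apply/eqP => cE.
  by move: c0; rewrite -cE => c00; have := cosh_gap0; rewrite c00 ltxx.
exists c => //; split=> [x y x0 xy yc|x y cx xy].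
  apply: (lt_of_is_derive xy (fun z => is_derive_logistic_gap z)).
  move=> z /andP[xz zy]; rewrite (logistic_gap_derive_sign z).1 -c0.
  by apply: cosh_gap_lt; [exact/ltW/(le_lt_trans x0)|exact: lt_le_trans yc].
rewrite -ltrN2.
apply: (@lt_of_is_derive (- logistic_gap r) _ _ _ xy
  (fun z => is_deriveN (is_derive_logistic_gap z))).
move=> z /andP[xz zy]; rewrite oppr_gt0 (logistic_gap_derive_sign z).2 -c0.
by apply: cosh_gap_lt => //; exact: le_lt_trans xz.
Qed.

(* With [K] increasing then decreasing, [K x = K (x / r)] forces the peak to lie
   between [x / r] and [x]; two such points would contradict monotonicity. *)
Lemma logistic_gap_crossing x y : 0 < x -> x < y ->
  logistic_gap r x = logistic_gap r (x / r) ->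
  logistic_gap r y = logistic_gap r (y / r) -> False.
Proof.
move=> x0 xy ex ey.
have r0 : 0 < r := lt_trans ltr01 r1.
have [c c0 [inc dec]] := logistic_gap_unimodal.
have y0 : 0 < y by exact: lt_trans xy.
have div z : 0 < z -> z / r < z by move=> z0; rewrite ltr_pdivrMr// ltr_pMr.
have div0 z : 0 < z -> 0 < z / r by move=> z0; rewrite divr_gt0.
have peak z : 0 < z -> logistic_gap r z = logistic_gap r (z / r) -> z / r < c < z.
  move=> z0 e; apply/andP; split; rewrite ltNge; apply/negP => h.
    by have := dec (z / r) z h (div _ z0); rewrite e ltxx.
  by have := inc (z / r) z (ltW (div0 _ z0)) (div _ z0) h; rewrite e ltxx.
have /andP[xc cx] := peak x x0 ex; have /andP[yc cy] := peak y y0 ey.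
have h1 := dec x y (ltW cx) xy.
have h2 : logistic_gap r (x / r) < logistic_gap r (y / r).
  by apply: inc; rewrite ?(ltW (div0 _ x0)) ?(ltW yc)// ltr_pM2r ?invr_gt0.
by move: h1; rewrite ex ey => /(lt_trans h2); rewrite ltxx.
Qed.

End gap.

(* With [N y = ln (1 + e^(- r y)) - ln (1 + e^(- y))] this is [N y - r N (y / r)]. *)
Definition log_profile r y : R :=
  ln (1 + expR (- (r * y))) + r * ln (1 + expR (- (r^-1 * y)))
  - (r + 1) * ln (1 + expR (- y)).

Lemma logodds_gt0 b : 0 < b < 1/2 -> 0 < ln ((1 - b) / b).
Proof.
by move=> /andP[b0 b1]; rewrite ln_gt0// ltr_pdivlMr// mul1r; lra.
Qed.

Lemma logodds_bnd y : 0 < y -> 0 < (1 + expR y)^-1 < 1/2.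
Proof.
move=> y0; have e1 : 1 < expR y by rewrite expR_gt1.
have e0 : 0 < 1 + expR y by lra.
rewrite invr_gt0 e0/= -[(_)^-1]div1r ltr_pdivrMr//; lra.
Qed.

Lemma logodds_inj b c : 0 < b < 1 -> 0 < c < 1 ->
  ln ((1 - b) / b) = ln ((1 - c) / c) -> b = c.
Proof.
move=> /andP[b0 b1] /andP[c0 c1] /ln_inj; rewrite !posrE !divr_gt0 ?subr_gt0//.
by move=> /(_ isT isT)/eqP; rewrite eqr_div ?(gt_eqF b0) ?(gt_eqF c0)// => /eqP; lra.
Qed.

Lemma powsum_logodds u y : powsum u (1 + expR y)^-1 =
  (1 + expR (- (u * y))) / (1 + expR (- y)) `^ u.
Proof.
have e0 : 0 < expR y by rewrite expR_gt0.
have d0 : 0 < 1 + expR y by lra.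
have d1 : 0 < 1 + expR (- y) by rewrite addr_gt0// expR_gt0.
rewrite /powsum; have -> : 1 - (1 + expR y)^-1 = (1 + expR (- y))^-1.
  by rewrite expRN; field; rewrite !gt_eqF.
have -> : (1 + expR y)^-1 = expR (- y) / (1 + expR (- y)).
  by rewrite expRN; field; rewrite !gt_eqF.
rewrite powRM ?invr_ge0 ?(ltW d1) ?expR_ge0// -expRM mulNr (mulrC y).
rewrite -[(1 + expR (- y))^-1]powR_inv1 ?(ltW d1)// powRAC powR_inv1 ?powR_ge0//.
by ring.
Qed.

Lemma ln_Rpb_logodds p y : 1 < p ->
  ln (Rpb p (1 + expR y)^-1) = log_profile (p - 1) y.
Proof.
move=> p1; have r0 : 0 < p - 1 by lra.
have d1 z : 0 < 1 + expR z by rewrite addr_gt0// expR_gt0.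
have b01 : 0 <= (1 + expR y)^-1 <= 1.
  by rewrite invr_ge0 (ltW (d1 _))/= invf_le1// lerDl expR_ge0.
rewrite (ln_Rpb _ b01) !powsum_logodds !ln_div ?posrE ?powR_gt0//.
rewrite !ln_powR /log_profile div1r.
by field; rewrite gt_eqF.
Qed.

(** In [N y - r N (y / r)] the factor [r] cancels the [1 / r] of the chain rule, so the derivative
    compares a single function at [y] and at [y / r]. *)
Lemma is_derive_log_profile r y : 0 < r -> is_derive y 1 (log_profile r)
  (logistic_gap r y - logistic_gap r (y / r)).
Proof.
move=> r0; have rn : r != 0 by rewrite gt_eqF.
have h1 := is_derive_softplus r y; have h2 := is_derive_softplus r^-1 y.
have h3 := is_derive_softplus 1 y.
have -> : log_profile r = (fun x => ln (1 + expR (- (r * x)))) +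
   r \*: (fun x => ln (1 + expR (- (r^-1 * x)))) -
   (r + 1) \*: (fun x => ln (1 + expR (- (1 * x)))).
  by apply/funext => x; rewrite !fctE /= /GRing.scale/= /log_profile mul1r.
apply: is_derive_eq; rewrite /GRing.scale/= /logistic_gap !mul1r.
rewrite (mulrC y) mulVKf//.
by field; rewrite rn !gt_eqF// addr_gt0 ?expR_gt0.
Qed.

Lemma Rpb_max_critical p b : 1 < p -> 0 < b < 1/2 ->
  (forall b', 0 <= b' <= 1/2 -> Rpb p b' <= Rpb p b) ->
  let y := ln ((1 - b) / b) in
  logistic_gap (p - 1) y = logistic_gap (p - 1) (y / (p - 1)).
Proof.
move=> p1 b12 bmax y; have r0 : 0 < p - 1 by lra.
case/andP: (b12) => b0 b1.
have y0 : 0 < y by exact: logodds_gt0.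
have bE : b = (1 + expR y)^-1.
  rewrite /y lnK ?posrE ?divr_gt0//; last by lra.
  by rewrite (_ : 1 + _ = b^-1) ?invrK//; field; rewrite gt_eqF.
have mx z : z \in `]0, (y + 1)[ -> log_profile (p - 1) z <= log_profile (p - 1) y.
  rewrite in_itv/= => /andP[z0 _].
  rewrite <- (ln_Rpb_logodds z p1), <- (ln_Rpb_logodds y p1); rewrite -bE.
  have /andP[w0 w1] := logodds_bnd z0.
  rewrite ler_ln ?posrE; last 2 first.
  - by apply: Rpb_gt0; apply/andP; split; lra.
  - by apply: Rpb_gt0; apply/andP; split; lra.
  by apply: bmax; rewrite !ltW.
have yI : y \in `]0, (y + 1)[ by rewrite in_itv/= y0/= ltrDl.
have y1 : 0 <= y + 1 by lra.
have h := @derive1_at_max R (log_profile (p - 1)) 0 (y + 1) y y1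
  (fun t _ => (@ex_derive _ _ _ _ _ _ _ (is_derive_log_profile t r0))) yI mx.
have := @derive_val _ _ _ _ _ _ _ h.
have -> := @derive_val _ _ _ _ _ _ _ (is_derive_log_profile y r0).
by move/eqP; rewrite subr_eq0 => /eqP.
Qed.

(** This is the predicate from which [bp] selects a point. *)
Definition is_Rpb_max p b :=
  0 <= b <= 1/2 /\ forall b', 0 <= b' <= 1/2 -> Rpb p b' <= Rpb p b.

Lemma is_Rpb_max_interior p b : 1 < p -> p != 2 -> is_Rpb_max p b -> 0 < b < 1/2.
Proof.
move=> p1 p2 [/andP[b0 b1] bmax].
have q12 : 0 < (1/4 : R) < 1/2 by apply/andP; split; lra.
have lt1 : 1 < Rpb p b.
  by apply: lt_le_trans (Rpb_gt1 p1 p2 q12) (bmax _ _); apply/andP; split; lra.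
rewrite !lt_neqAle b0 b1 !andbT; apply/andP; split; apply: contraTneq lt1.
  by move=> <-; rewrite (Rpb0 p1) ltxx.
by move=> ->; rewrite (Rpb_half p1) ltxx.
Qed.

Lemma is_Rpb_max_conj p b : 1 < p -> is_Rpb_max (p / (p - 1)) b <-> is_Rpb_max p b.
Proof.
move=> p1; have s0 : 0 < 1 / (p - 1) by rewrite divr_gt0// subr_gt0.
have W (c : R) : 0 <= c <= 1/2 -> 0 <= c <= 1 by move=> /andP[? ?]; apply/andP; split; lra.
have key c : 0 <= b <= 1/2 -> 0 <= c <= 1/2 ->
   (Rpb (p / (p - 1)) c <= Rpb (p / (p - 1)) b) = (Rpb p c <= Rpb p b).
  move=> /W hb /W hc; have eb := Rpb_conj p1 hb; have ec := Rpb_conj p1 hc.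
  rewrite -> eb, ec; apply/idP/idP; last first.
    by apply: ge0_ler_powR; rewrite ?nnegrE ?(ltW s0) ?(ltW (Rpb_gt0 _ hb)) ?(ltW (Rpb_gt0 _ hc)).
  apply: contraTT; rewrite -!ltNge.
  by apply: gt0_ltr_powR; rewrite ?nnegrE ?(ltW (Rpb_gt0 _ hb)) ?(ltW (Rpb_gt0 _ hc)).
split=> -[hb bmax]; (split; first exact: hb) => c hc.
  by rewrite <- (key c hb hc); exact (bmax c hc).
by rewrite -> (key c hb hc); exact (bmax c hc).
Qed.

Lemma is_Rpb_max_uniq p b c : 1 < p -> p != 2 -> is_Rpb_max p b -> is_Rpb_max p c ->
  b = c.
Proof.
(* Conjugation preserves maximizers and exchanges the two sides of 2, so [p - 1 > 1] may be assumed,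
   as the crossing argument requires. *)
wlog p2 : p / 2 < p.
  move=> wl p1 p2; have [p2'|p2'] := ltP 2 p; first exact: wl.
  have {p2'} p2' : p < 2 by rewrite lt_neqAle p2.
  move=> hb0 hc0; have hb := (is_Rpb_max_conj b p1).2 hb0.
  have hc := (is_Rpb_max_conj c p1).2 hc0.
  have q2 : 2 < p / (p - 1) by rewrite ltr_pdivlMr ?subr_gt0//; lra.
  by apply: (wl _ q2 (conj_gt1 p1) _ hb hc); rewrite gt_eqF.
move=> p1 pn2 hb hc.
have hb' := is_Rpb_max_interior p1 pn2 hb; have hc' := is_Rpb_max_interior p1 pn2 hc.
have cb := Rpb_max_critical p1 hb' hb.2; have cc := Rpb_max_critical p1 hc' hc.2.
have r1 : 1 < p - 1 by lra.
have W (z : R) : 0 < z < 1/2 -> 0 < z < 1.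
  by move=> /andP[? ?]; apply/andP; split; lra.
apply: logodds_inj; [exact: W|exact: W|].
case: (ltgtP (ln ((1 - b) / b)) (ln ((1 - c) / c))) => // h.
  by case: (logistic_gap_crossing r1 (logodds_gt0 hb') h cb cc).
by case: (logistic_gap_crossing r1 (logodds_gt0 hc') h cc cb).
Qed.

(** Existence of a maximizer excludes the default value 0 of [xget]. *)
Lemma bp_max p : 1 < p -> is_Rpb_max p (bp p).
Proof.
move=> p1; have [b /andP[b0 b1] bmax] := Rpb_max_exists p1.
have hb : is_Rpb_max p b.
  split; first by rewrite !ltW.
  by move=> c /andP[c0 c1]; apply: bmax; apply/andP; split; lra.
by rewrite /bp; case: xgetP => [_ -> //|/(_ b)].
Qed.

(** Conjugate exponents have the same set of maximizers, so [xget] picks the same point. *)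
Lemma bp_conj p : 1 < p -> bp (p / (p - 1)) = bp p.
Proof.
move=> p1; have E : [set b | is_Rpb_max (p / (p - 1)) b] = [set b | is_Rpb_max p b].
  by apply/funext => b; apply/propext; exact (is_Rpb_max_conj b p1).
exact (congr1 (xget 0) E).
Qed.

End unimodality.

(** * The two-point inequality *)

Section two_point_inequality.
Variable R : realType.
Implicit Types p a b c t y k l C : R.

Lemma powsum_scale u a b : 0 < a -> 0 < b ->
  a `^ u + b `^ u = (a + b) `^ u * powsum u (b / (a + b)).
Proof.
move=> a0 b0; have L0 : 0 < a + b by rewrite addr_gt0.
have Ln : a + b != 0 by rewrite gt_eqF.
have -> : powsum u (b / (a + b)) = (b / (a + b)) `^ u + (a / (a + b)) `^ u.
  by rewrite /powsum (_ : 1 - b / (a + b) = a / (a + b)) //; field.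
have sc c : 0 < c -> (a + b) `^ u * (c / (a + b)) `^ u = c `^ u.
  by move=> c0; rewrite -powRM ?divr_ge0 ?(ltW c0) ?(ltW L0)// mulrC divfK.
by rewrite mulrDr !sc// addrC.
Qed.

(** Dividing by the length [a + b] reduces [two_point_center_ge] to the ratio [b / (a + b)]; the two
    power sums that appear combine into [R], and the optimal centre is [tb] rescaled by [a + b]. *)
Lemma two_point_le p a b t : 1 < p -> 0 < a -> 0 < b ->
  a * b `^ p + b * a `^ p <=
    Rpb p (b / (a + b)) * (a * `|b - t| `^ p + b * `|a + t| `^ p)
    ?= iff (t == (a + b) * tb p (b / (a + b))).
Proof.
move=> p1 a0 b0; have L0 : 0 < a + b by rewrite addr_gt0.
have Ln : a + b != 0 by rewrite gt_eqF.
have p0 : 0 < p by lra.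
have r0 : 0 < p - 1 by lra.
set be := b / (a + b); set T := a * `|b - t| `^ p + _.
have be01 : 0 < be < 1.
  by rewrite divr_gt0//= ltr_pdivrMr// mul1r ltrDr.
have be01' : 0 <= be <= 1 by case/andP: be01 => ? ?; rewrite !ltW.
have P0 : 0 < powsum (p - 1) be by exact: powsum_gt0.
have Q0 : 0 < powsum (1 / (p - 1)) be by exact: powsum_gt0.
have := @two_point_center_ge R p p1 a b t a0 b0 => /=.
rewrite (powsum_scale (1 / (p - 1)) a0 b0) -/be -/T.
rewrite powRM ?powR_ge0 ?(ltW Q0)// (conj_expK p1 (ltW L0)).
rewrite -[in X in X -> _](@mulr_powRB1 _ (a + b))// ?(ltW L0)//.
have -> : a * b `^ p + b * a `^ p =
   (a + b) `^ (p - 1) * powsum (p - 1) be * (a * b).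
  rewrite -(powsum_scale (p - 1) a0 b0) -(@mulr_powRB1 _ b) ?(ltW b0)//.
  by rewrite -(@mulr_powRB1 _ a) ?(ltW a0)//; ring.
have -> : b - (a + b) * (b `^ (1 / (p - 1)) / ((a + b) `^ (1 / (p - 1)) * powsum (1 / (p - 1)) be))
   = (a + b) * tb p be.
  have -> : b `^ (1 / (p - 1)) = (a + b) `^ (1 / (p - 1)) * be `^ (1 / (p - 1)).
    by rewrite -powRM ?divr_ge0 ?(ltW b0) ?(ltW L0)// /be [(a + b) * _]mulrC divfK.
  rewrite /tb -/(powsum (1 / (p - 1)) be) /be.
  by field; rewrite Ln !gt_eqF// powR_gt0.
rewrite RpbE.
set P := powsum (p - 1) be; set Q := powsum (1 / (p - 1)) be `^ (p - 1).
set Lr := (a + b) `^ (p - 1).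
have K0 : 0 < P / (a + b) by rewrite divr_gt0.
move=> [h1 h2].
have e1 : Lr * P * (a * b) = P / (a + b) * (a * b * ((a + b) * Lr)) by field.
have e2 : P * Q * T = P / (a + b) * ((a + b) * Q * T) by field.
split; first by rewrite e1 e2 ler_pM2l.
by rewrite -h2 e1 e2; apply/eqP/eqP => [|->//]; apply: mulfI; rewrite gt_eqF.
Qed.

(* The hypothesis says [- g (- a) / a <= g b / b], so any slope in between works. *)
Lemma exists_supporting_slope (g : R -> R) : 0 <= g 0 ->
  (forall a b, 0 < a -> 0 < b -> 0 <= a * g b + b * g (- a)) ->
  exists k, forall y, k * y <= g y.
Proof.
move=> g0 hg.
pose S := [set - g (- a) / a | a in [set a | 0 < a]].
have hS b : 0 < b -> ubound S (g b / b).
  move=> b0 _ [a /= a0 <-]; have := hg a b a0 b0.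
  rewrite ler_pdivlMr// mulrAC ler_pdivrMr//; lra.
have S0 : S !=set0 by exists (- g (- 1) / 1); exists 1 => /=.
exists (sup S) => y; have [y0|y0|<-] := ltgtP 0 y; last by rewrite mulr0.
  by rewrite -ler_pdivlMr//; apply: ge_sup => //; exact: hS.
have ny : 0 < - y by rewrite oppr_gt0.
have : - g (- - y) / (- y) <= sup S.
  apply: ub_le_sup; first by exists (g 1 / 1); exact: hS.
  by exists (- y).
rewrite opprK ler_pdivrMr//; lra.
Qed.

Lemma exists_centering_slope p C t : 1 < p ->
  (forall b, 0 <= b <= 1 -> Rpb p b <= C) ->
  exists k, forall y, k * y <= C * `|y - t| `^ p - `|y| `^ p.
Proof.
move=> p1 hC; apply: exists_supporting_slope => [|a b a0 b0].
  rewrite normr0 powR0 ?subr0; last by rewrite gt_eqF//; lra.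
  rewrite mulr_ge0 ?powR_ge0//; apply: le_trans (hC 0 _); last by rewrite lexx ler01.
  by apply/ltW/Rpb_gt0; rewrite lexx ler01.
have L0 : 0 < a + b by rewrite addr_gt0.
have be01' : 0 <= b / (a + b) <= 1.
  by rewrite divr_ge0 ?(ltW b0) ?(ltW L0)//= ler_pdivrMr// mul1r lerDr ltW.
have [h _] := two_point_le t p1 a0 b0.
rewrite (gtr0_norm b0) normrN (gtr0_norm a0).
rewrite (_ : - a - t = - (a + t)) ?normrN; last by ring.
set T1 := `|b - t| `^ p in h *; set T2 := `|a + t| `^ p in h *.
have T0 : 0 <= a * T1 + b * T2 by rewrite addr_ge0// mulr_ge0 ?powR_ge0 ?ltW.
have h2 := ler_wpM2r T0 (hC _ be01').
have := le_trans h h2; rewrite -subr_ge0; congr (is_true (_ <= _)).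
by ring.
Qed.

Lemma tb_onem p b : 0 <= b <= 1 -> tb p (1 - b) = - tb p b.
Proof.
move=> /(powsum_gt0 (1 / (p - 1))); rewrite /tb subKr /powsum.
set x := b `^ _; set y := (1 - b) `^ _ => xy0.
by rewrite [y + x]addrC; field; rewrite gt_eqF.
Qed.

(* Any two pairs at which the two-point inequality is an equality coincide: the
   ratio is fixed up to swapping by the maximizer, the sign of [t] decides
   which, and [t] itself gives the scale. *)
Lemma two_point_eq_uniq p C t a b a' b' : 1 < p -> p != 2 -> t != 0 ->
  C = Rpb p (bp p) -> 0 < a -> 0 < b -> 0 < a' -> 0 < b' ->
  a * b `^ p + b * a `^ p = C * (a * `|b - t| `^ p + b * `|a + t| `^ p) ->
  a' * b' `^ p + b' * a' `^ p = C * (a' * `|b' - t| `^ p + b' * `|a' + t| `^ p) ->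
  (a' = a /\ b' = b) /\
  exists2 l, l != 0 & (t = l * tb p (bp p) /\
   ((b = l * bp p /\ a = l * (1 - bp p)) \/ (b = - l * (1 - bp p) /\ a = - l * bp p))).
Proof.
move=> p1 p2 t0 CE.
have hm := bp_max p1; have [bI bmax] := hm.
have p0 : 0 < p by lra.
have bI1 := is_Rpb_max_interior p1 p2 hm.
have bmax1 c : 0 <= c <= 1 -> Rpb p c <= C.
  rewrite CE => /andP[c0 c1]; have [c12|c12] := leP c (1/2).
    by apply: bmax; rewrite c0.
  have c' : 0 <= 1 - c <= 1/2 by clear - c0 c1 c12; apply/andP; split; lra.
  by have := bmax _ c'; rewrite -> (Rpb_onem p c).
have key a1 b1 : 0 < a1 -> 0 < b1 ->
  a1 * b1 `^ p + b1 * a1 `^ p = C * (a1 * `|b1 - t| `^ p + b1 * `|a1 + t| `^ p) ->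
  t = (a1 + b1) * tb p (b1 / (a1 + b1)) /\
  (b1 / (a1 + b1) = bp p \/ b1 / (a1 + b1) = 1 - bp p).
  move=> a0 b0 E; have L0 : 0 < a1 + b1 by rewrite addr_gt0.
  have be01 : 0 <= b1 / (a1 + b1) <= 1.
    by rewrite divr_ge0 ?(ltW b0) ?(ltW L0)//= ler_pdivrMr// mul1r lerDr ltW.
  have [h1 h2] := two_point_le t p1 a0 b0.
  set T := a1 * _ + b1 * `|a1 + t| `^ p in E h1 h2.
  have lhs0 : 0 < a1 * b1 `^ p + b1 * a1 `^ p by rewrite addr_gt0// mulr_gt0// powR_gt0.
  have C0 : 0 < C by rewrite CE; apply: Rpb_gt0; clear - bI1; case/andP: bI1 => ? ?; apply/andP; split; lra.
  have T0 : 0 < T by rewrite -(pmulr_rgt0 _ C0) -E.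
  (* The left side is at most [R T], hence at most [C T], which is the left side again; as [T > 0],
     both steps are equalities. *)
  have eR : Rpb p (b1 / (a1 + b1)) = C.
    apply/le_anti/andP; split; first exact: bmax1.
    by rewrite -(ler_pM2r T0) -E.
  split; first by apply/eqP; rewrite -h2 eR E.
  have [c12|c12] := leP (b1 / (a1 + b1)) (1/2); [left|right].
    apply: (is_Rpb_max_uniq p1 p2); last exact: bp_max.
    case/andP: be01 => e0 e1; split; first by rewrite e0.
    by rewrite -> eR, CE; exact: bmax.
  have c' : 0 <= 1 - b1 / (a1 + b1) <= 1/2.
    by clear - be01 c12; case/andP: be01 => ? ?; apply/andP; split; lra.
  have : 1 - b1 / (a1 + b1) = bp p.
    apply: (is_Rpb_max_uniq p1 p2); last exact: bp_max.
    split; first exact: c'.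
    by rewrite -> (Rpb_onem p (b1 / (a1 + b1))), eR, CE; exact: bmax.
  by move=> <-; rewrite subKr.
have tbN : tb p (1 - bp p) = - tb p (bp p).
  by apply: tb_onem; clear - bI1; case/andP: bI1 => ? ?; apply/andP; split; lra.
move=> a0 b0 a0' b0' E E'.
have L0 : 0 < a + b by rewrite addr_gt0.
have L0' : 0 < a' + b' by rewrite addr_gt0.
have [tE bE] := key _ _ a0 b0 E; have [tE' bE'] := key _ _ a0' b0' E'.
have bE2 : b = (a + b) * (b / (a + b)) by field; rewrite gt_eqF.
have bE2' : b' = (a' + b') * (b' / (a' + b')) by field; rewrite gt_eqF.
clear - t0 tE bE tE' bE' tbN L0 L0' bE2 bE2'.
set L := a + b in tE bE L0 bE2 *; have aE : a = L - b by rewrite /L; ring.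
set L' := a' + b' in tE' bE' L0' bE2' *; have aE' : a' = L' - b' by rewrite /L'; ring.
have tb0 : tb p (bp p) != 0.
  apply: contraNneq t0 => h; move: tE; case: bE => -> ->; rewrite ?tbN h ?oppr0 ?mulr0//.
clearbody L L'; subst a a'.
(* If one pair had ratio [bp p] and the other [1 - bp p], then [t] would be both a positive and a
   negative multiple of the nonzero [tb p (bp p)]. The reflected case gives the negative scale
   [- L]. *)
case: bE => e; rewrite e in tE bE2; case: bE' => e'; rewrite e' in tE' bE2'; rewrite ?tbN in tE tE'.
- have LL : L' = L by apply: (mulIf tb0); rewrite -tE.
  split; first by rewrite bE2' bE2 LL.
  by exists L; [rewrite gt_eqF|split=> //; left; split=> //; rewrite bE2; ring].
- exfalso; have /(mulIf tb0) LL : L * tb p (bp p) = - L' * tb p (bp p).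
    by rewrite -tE {1}tE'; ring.
  lra.
- exfalso; have /(mulIf tb0) LL : L' * tb p (bp p) = - L * tb p (bp p).
    by rewrite -tE' {1}tE; ring.
  lra.
- have LL : L' = L.
    have /(mulIf tb0) : L' * tb p (bp p) = L * tb p (bp p) by move: tE tE'; lra.
    exact.
  split; first by rewrite bE2' bE2 LL.
  exists (- L); first by rewrite oppr_eq0 gt_eqF.
  split; first by rewrite {1}tE; ring.
  by right; split; rewrite bE2; ring.
Qed.

End two_point_inequality.

(** * Moments *)

Section moments.
Context (d : measure_display) (T : measurableType d) (R : realType).
Variable P : probability T R.
Implicit Types (X : {RV P >-> R}) (p C k c : R).

Lemma measurable_abs_powR X p c : measurable_fun setT (fun x => `|X x - c| `^ p).
Proof.
apply: (measurableT_comp (measurable_powR p)).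
by apply: measurableT_comp => //; exact: measurable_funB.
Qed.

Lemma measurable_abs_powR0 X p : measurable_fun setT (fun x => `|X x| `^ p).
Proof.
apply: (measurableT_comp (measurable_powR p)).
exact: measurableT_comp.
Qed.

Lemma mean_fin X : P.-integrable setT (EFin \o X) -> 'E_P[X]%E = (fine 'E_P[X])%:E.
Proof. by move=> iX; rewrite fineK// expectation_def integrable_fin_num. Qed.

Lemma integrable_affine X c k : P.-integrable setT (EFin \o X) ->
  P.-integrable setT (fun x => (c + k * X x)%:E).
Proof.
move=> iX.
have i1 : P.-integrable setT (EFin \o cst c) by exact: finite_measure_integrable_cst.
have i2 : P.-integrable setT (fun x => k%:E * (EFin \o X) x)%E by exact: integrableZl.
by apply: eq_integrable (integrableD measurableT i1 i2).
Qed.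

Lemma integral_affine X c k : P.-integrable setT (EFin \o X) ->
  (\int[P]_x (c + k * X x)%:E = (c + k * fine 'E_P[X])%:E)%E.
Proof.
move=> iX.
have i1 : P.-integrable setT (EFin \o cst c) by exact: finite_measure_integrable_cst.
have i2 : P.-integrable setT (fun x => k%:E * (EFin \o X) x)%E by exact: integrableZl.
have h := integralD measurableT i1 i2.
have -> : (\int[P]_x (c + k * X x)%:E = \int[P]_x ((EFin \o cst c) x + k%:E * (EFin \o X) x))%E.
  by apply: eq_integral => x _; rewrite /= EFinD EFinM.
rewrite h (integralZl measurableT iX) EFinD EFinM -(mean_fin iX) expectation_def.
congr (_ + _)%E.
have -> : (EFin \o cst c : T -> \bar R) = cst c%:E by [].
by rewrite integral_cst//= probability_setT mule1.
Qed.

(** The pointwise bound dominates [|X - m|^p] by the integrable [C |X|^p - k (X - m)]. Both moments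
    are therefore real numbers and can be subtracted, and the linear term integrates to 0. *)
Lemma moment_gap X p C k : 1 < p -> P.-integrable setT (EFin \o X) ->
  (\int[P]_x (`|X x| `^ p)%:E < +oo)%E ->
  let m := fine 'E_P[X]%E in
  (forall y, k * (y - m) <= C * `|y| `^ p - `|y - m| `^ p) ->
  exists I0 I1 : R, [/\ (\int[P]_x (`|X x| `^ p)%:E = I0%:E)%E,
    (\int[P]_x (`|X x - m| `^ p)%:E = I1%:E)%E, 0 <= I0, 0 <= I1 &
    (\int[P]_x (C * `|X x| `^ p - `|X x - m| `^ p - k * (X x - m))%:E
      = (C * I0 - I1)%:E)%E].
Proof.
move=> p1 iX fin m hk.
have iA : P.-integrable setT (fun x => (`|X x| `^ p)%:E).
  apply/integrableP; split; first by apply/measurable_EFinP; exact: measurable_abs_powR0.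
  rewrite (_ : (\int[P]_x `|_|)%E = (\int[P]_x (`|X x| `^ p)%:E)%E)//.
  by apply: eq_integral => x _; rewrite /= ger0_norm// powR_ge0.
have iL : P.-integrable setT (fun x => (- (k * m) + k * X x)%:E) by exact: integrable_affine.
have iCA : P.-integrable setT (fun x => C%:E * (`|X x| `^ p)%:E)%E by exact: integrableZl.
have iCL := integrableB measurableT iCA iL.
have iB : P.-integrable setT (fun x => (`|X x - m| `^ p)%:E).
  apply: (le_integrable measurableT _ _ iCL).
    by apply/measurable_EFinP; exact: measurable_abs_powR.
  move=> x _ /=; rewrite lee_fin ger0_norm ?powR_ge0//.
  apply: le_trans (ler_norm _); have := hk (X x).
  by rewrite mulrBr => h; lra.
have fA := integrable_fin_num measurableT iA; have fB := integrable_fin_num measurableT iB.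
exists (fine (\int[P]_x (`|X x| `^ p)%:E)), (fine (\int[P]_x (`|X x - m| `^ p)%:E)).
split; rewrite ?fineK//.
- by apply: fine_ge0; apply: integral_ge0 => x _; rewrite lee_fin powR_ge0.
- by apply: fine_ge0; apply: integral_ge0 => x _; rewrite lee_fin powR_ge0.
rewrite EFinB EFinM !fineK//.
have -> : (\int[P]_x (C * `|X x| `^ p - `|X x - m| `^ p - k * (X x - m))%:E =
  \int[P]_x ((C%:E * (`|X x| `^ p)%:E - (- (k * m) + k * X x)%:E) - (`|X x - m| `^ p)%:E))%E.
  by apply: eq_integral => x _; rewrite -EFinM -!EFinB; congr EFin; ring.
rewrite (integralB measurableT iCL iB) (integralB measurableT iCA iL).
rewrite (integralZl measurableT iA) (integral_affine _ _ iX) -/m.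
by rewrite (_ : - (k * m) + k * m = 0) ?sube0//; ring.
Qed.

Lemma moment_gap_ge0 X p C k : 1 < p -> P.-integrable setT (EFin \o X) ->
  let m := fine 'E_P[X]%E in 0 < C ->
  (forall y, k * (y - m) <= C * `|y| `^ p - `|y - m| `^ p) ->
  (\int[P]_x (`|X x - m| `^ p)%:E <= C%:E * \int[P]_x (`|X x| `^ p)%:E)%E.
Proof.
move=> p1 iX m C0 hk.
have [fin|] := boolP (\int[P]_x (`|X x| `^ p)%:E < +oo)%E; last first.
  by rewrite -leNgt leye_eq => /eqP ->; rewrite gt0_muley ?lte_fin// leey.
have [I0 [I1 [-> -> i0 i1 gap]]] := moment_gap p1 iX fin hk.
rewrite -EFinM lee_fin -subr_ge0 -lee_fin -gap.
by apply: integral_ge0 => x _; rewrite lee_fin subr_ge0.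
Qed.

Lemma moment_gap_eq0 X p C k : 1 < p -> P.-integrable setT (EFin \o X) ->
  let m := fine 'E_P[X]%E in
  (\int[P]_x (`|X x| `^ p)%:E < +oo)%E ->
  (forall y, k * (y - m) <= C * `|y| `^ p - `|y - m| `^ p) ->
  (\int[P]_x (`|X x - m| `^ p)%:E = C%:E * \int[P]_x (`|X x| `^ p)%:E)%E ->
  {ae P, forall x, C * `|X x| `^ p - `|X x - m| `^ p = k * (X x - m)}.
Proof.
move=> p1 iX m fin hk.
have [I0 [I1 [-> -> i0 i1 gap]]] := moment_gap p1 iX fin hk.
rewrite -EFinM => -[e].
pose h x := (C * `|X x| `^ p - `|X x - m| `^ p - k * (X x - m))%:E.
have mh : measurable_fun setT h.
  apply/measurable_EFinP; apply: measurable_funB; last first.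
    by apply: measurable_funM => //; exact: measurable_funB.
  apply: measurable_funB; last exact: measurable_abs_powR.
  by apply: measurable_funM => //; exact: measurable_abs_powR0.
have : (\int[P]_x `|h x| = 0)%E.
  transitivity (C * I0 - I1)%:E; last by rewrite e subrr.
  by rewrite -gap; apply: eq_integral => x _; rewrite gee0_abs// lee_fin subr_ge0.
move/(ae_eq_integral_abs P measurableT mh).
apply: filterS => x /(_ I) /= [/eqP]; rewrite subr_eq0 => /eqP; exact.
Qed.

(** From [|X| <= 2 max (|X - c|, |c|)] follows [|X|^p <= 2^p (|X - c|^p + |c|^p)]. Hence both sides
    of the centering inequality are infinite together. *)
Lemma moment_shift_infty X p c : 1 < p ->
  (\int[P]_x (`|X x| `^ p)%:E = +oo)%E -> (\int[P]_x (`|X x - c| `^ p)%:E = +oo)%E.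
Proof.
move=> p1 inf; apply/eqP; rewrite -leye_eq leNgt; apply/negP => fin.
have p0 : 0 <= p by lra.
have : (\int[P]_x (`|X x| `^ p)%:E <=
   \int[P]_x ((2 `^ p * `|X x - c| `^ p)%:E + (2 `^ p * `|c| `^ p)%:E))%E.
  apply: ge0_le_integral => //.
  - by apply/measurable_EFinP; exact: measurable_abs_powR0.
  - by apply: emeasurable_funD => //; apply/measurable_EFinP; apply: measurable_funM => //; exact: measurable_abs_powR.
  move=> x _; rewrite -EFinD lee_fin.
  have hx : `|X x| <= 2 * Num.max `|X x - c| `|c|.
    have := ler_normD (X x - c) c; rewrite subrK => h.
    have h1 : `|X x - c| <= Num.max `|X x - c| `|c| by rewrite le_max lexx.
    have h2 : `|c| <= Num.max `|X x - c| `|c| by rewrite le_max lexx orbT.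
    lra.
  have m0 : 0 <= Num.max `|X x - c| `|c| by rewrite le_max normr_ge0.
  apply: (@le_trans _ _ ((2 * Num.max `|X x - c| `|c|) `^ p)).
    by apply: ge0_ler_powR; rewrite ?nnegrE// mulr_ge0.
  rewrite powRM// -mulrDr ler_pM2l ?powR_gt0//.
  by case: (leP `|X x - c| `|c|) => _; rewrite ?lerDr ?lerDl powR_ge0.
rewrite inf ge0_integralD//; last first.
  by apply/measurable_EFinP; apply: measurable_funM => //; exact: measurable_abs_powR.
rewrite leye_eq => /eqP.
under eq_integral do rewrite EFinM.
rewrite ge0_integralZl_EFin ?powR_ge0//; last first.
  by apply/measurable_EFinP; exact: measurable_abs_powR.
have -> : (\int[P]_x (2 `^ p * `|c| `^ p)%:E)%E = (2 `^ p * `|c| `^ p)%:E.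
  by rewrite integral_cst//= probability_setT mule1.
have f1 : (0 <= \int[P]_x (`|X x - c| `^ p)%:E)%E.
  by apply: integral_ge0 => x _; rewrite lee_fin powR_ge0.
move: fin f1; case: (\int[P]_x _)%E => //.
Qed.

(** If [X - m] kept one sign on [Q], its zero mean would force [X = m] almost surely. The lemma
    extracts actual sample points, with any almost sure property [Q], from a statement about
    integrals. *)
Lemma centered_takes_both_signs X (Q : T -> Prop) : P.-integrable setT (EFin \o X) ->
  let m := fine 'E_P[X]%E in {ae P, forall x, Q x} ->
  (exists2 x, Q x & X x = m) \/
  ((exists2 x, Q x & m < X x) /\ (exists2 x, Q x & X x < m)).
Proof.
move=> iX m aQ.
have aeex (S : T -> Prop) : {ae P, forall x, S x} -> exists x, S x.
  move=> aS; apply/not_existsP => nS.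
  have : P setT = 0 by apply/negligibleP => //; apply: negligibleS aS => x _ /=; exact: nS.
  by rewrite probability_setT => /eqP; rewrite onee_eq0.
have key (s : R) : s != 0 -> (forall x, Q x -> 0 <= s * (X x - m)) -> exists2 x, Q x & X x = m.
  move=> s0 hs.
  pose h x := (- (s * m) + s * X x)%:E : \bar R.
  have mh : measurable_fun setT h.
    apply/measurable_EFinP; apply: measurable_funD => //.
    by apply: measurable_funM.
  have : (\int[P]_x `|h x| = 0)%E.
    transitivity (\int[P]_x h x)%E; last first.
      by rewrite (integral_affine _ _ iX) -/m addrC subrr.
    apply: ae_eq_integral => //; first exact: measurableT_comp.
    apply: filterS aQ => x Qx _; rewrite gee0_abs// lee_fin.
    by have := hs x Qx; rewrite mulrBr addrC.
  move/(ae_eq_integral_abs P measurableT mh) => ah.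
  have [x [Qx /(_ I)/= [hx]]] := aeex _ (filterI aQ ah).
  exists x => //; have /eqP : s * (X x - m) = 0 by rewrite -hx; ring.
  by rewrite mulf_eq0 (negbTE s0)/= subr_eq0 => /eqP.
have [h1|n1] := pselect (exists2 x, Q x & m < X x); last first.
  left; apply: (key (-1)); first by rewrite oppr_eq0 oner_eq0.
  move=> x Qx; rewrite mulN1r oppr_ge0 subr_le0 leNgt; apply/negP => h.
  by apply: n1; exists x.
have [h2|n2] := pselect (exists2 x, Q x & X x < m); last first.
  left; apply: (key 1); first by rewrite oner_eq0.
  move=> x Qx; rewrite mul1r subr_ge0 leNgt; apply/negP => h.
  by apply: n2; exists x.
by right.
Qed.

Lemma ae_two_valued_law X (v1 v2 w1 w2 : R) : P.-integrable setT (EFin \o X) ->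
  v1 != v2 -> w1 + w2 = 1 -> w1 * v1 + w2 * v2 = fine 'E_P[X]%E ->
  {ae P, forall x, X x = v1 \/ X x = v2} ->
  forall A, measurable A -> P (X @^-1` A) = (w1 * \1_A v1 + w2 * \1_A v2)%:E.
Proof.
move=> iX v12 w12 mE aX A mA.
have mXA : measurable (X @^-1` A).
  by rewrite -[_ @^-1` _]setTI; exact: (measurable_funP X).
rewrite -[X @^-1` A]setIT -(integral_indic P measurableT mXA).
have v120 : v1 - v2 != 0 by rewrite subr_eq0.
(* an indicator of a two-valued variable is an affine function of it *)
pose k := (\1_A v1 - \1_A v2) / (v1 - v2) : R.
pose c := \1_A v1 - k * v1 : R.
transitivity (\int[P]_x (c + k * X x)%:E)%E.
  apply: ae_eq_integral => //.
  - by apply/measurable_EFinP; exact: measurable_indic.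
  - by apply/measurable_EFinP; apply: measurable_funD => //; apply: measurable_funM.
  apply: filterS aX => x aX _; congr EFin.
  have -> : \1_(X @^-1` A) x = \1_A (X x) :> R by [].
  by case: aX => ->; rewrite /c /k; field.
rewrite (integral_affine _ _ iX) -mE; congr EFin.
have -> : w2 = 1 - w1 by rewrite -w12; ring.
by rewrite /c /k; field.
Qed.

End moments.

(** * The best constant *)

Section laws.
Context (d : measure_display) (T : measurableType d) (R : realType).
Variable P : probability T R.
Implicit Types (X : {RV P >-> R}) (p C k c lam b : R).

(** The integral is carried over to the image measure, which agrees with a sum of two scaled Dirac
    masses. *)
Lemma ge0_integral_two_point_law X (v1 v2 w1 w2 : R) (f : R -> R) :
  0 <= w1 -> 0 <= w2 ->
  (forall A, measurable A -> P (X @^-1` A) = (w1 * \1_A v1 + w2 * \1_A v2)%:E) ->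
  measurable_fun setT f -> (forall x, 0 <= f x) ->
  (\int[P]_x (f (X x))%:E = (w1 * f v1 + w2 * f v2)%:E)%E.
Proof.
move=> w10 w20 law mf f0.
have mfE : measurable_fun setT (EFin \o f) by apply/measurable_EFinP.
have f0E y : (0 <= (EFin \o f) y)%E by rewrite lee_fin.
have -> : (\int[P]_x (f (X x))%:E = \int[P]_x ((EFin \o f) \o X) x)%E by [].
rewrite -(@ge0_integral_distribution _ _ _ _ _ P X _ mfE f0E).
pose m := measure_add (mscale (NngNum w10) \d_v1) (mscale (NngNum w20) \d_v2).
rewrite (@eq_measure_integral _ _ _ setT m); last first.
  move=> A mA _; have e := @measure_addE _ _ R (mscale (NngNum w10) \d_v1)
    (mscale (NngNum w20) \d_v2) A.
  apply: etrans (esym e); rewrite /mscale/= -[LHS]/(P (X @^-1` A)).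
  by rewrite law// EFinD !EFinM !diracE /indic.
rewrite ge0_integral_measure_add// !ge0_integral_mscale//=.
  by rewrite !integral_dirac//= !diracT !mul1e -!EFinM.
all: by move=> x _; rewrite lee_fin.
Qed.

Lemma two_point_law_moments X b lam (t : R) p : 0 < b < 1 ->
  P.-integrable setT (EFin \o X) ->
  same_law_scaled_twopoint X (1 - b) b lam t -> 
  fine 'E_P[X]%E = - (lam * t) /\
  (forall c, (\int[P]_x (`|X x - c| `^ p)%:E =
    ((1 - b) * `|lam * (b - t) - c| `^ p + b * `|lam * (- (1 - b) - t) - c| `^ p)%:E)%E).
Proof.
move=> /andP[b0 b1] iX law.
have b1' : 0 <= 1 - b by rewrite subr_ge0 ltW.
have w A : measurable A -> P (X @^-1` A) =
    ((1 - b) * \1_A (lam * (b - t)) + b * \1_A (lam * (- (1 - b) - t)))%:E.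
  by move=> /law ->; rewrite !subrK !divr1.
have I f := @ge0_integral_two_point_law X _ _ _ _ f b1' (ltW b0) w.
split; last first.
  move=> c; apply: (I (fun y => `|y - c| `^ p)); last by move=> ?; rewrite powR_ge0.
  apply: (measurableT_comp (measurable_powR p)).
  by apply: measurableT_comp => //; exact: measurable_funB.
(* The formula for nonnegative functions is applied to the positive and the negative part of [X]. *)
rewrite expectation_def integralE.
have -> : (\int[P]_x (fun x => (X x)%:E)^\+ x)%E = (\int[P]_x (Num.max (X x) 0)%:E)%E.
  by apply: eq_integral => x _; rewrite funeposE -EFin_max.
have -> : (\int[P]_x (fun x => (X x)%:E)^\- x)%E = (\int[P]_x (Num.max (- X x) 0)%:E)%E.
  by apply: eq_integral => x _; rewrite funenegE -EFinN -EFin_max.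
have mx : measurable_fun setT (fun y : R => Num.max y 0) by exact: measurable_maxr.
have mn : measurable_fun setT (fun y : R => Num.max (- y) 0).
  by apply: measurable_maxr => //; exact: measurableT_comp.
rewrite (I (fun y => Num.max y 0))//; last by move=> ?; rewrite le_max lexx orbT.
rewrite (I (fun y => Num.max (- y) 0))//; last by move=> ?; rewrite le_max lexx orbT.
have mm (z : R) : Num.max z 0 - Num.max (- z) 0 = z.
  case: (leP z 0) => z0; case: (leP (- z) 0) => z0'; rewrite ?oppr_le0 ?oppr_gt0 in z0 z0'; lra.
rewrite -EFinB /=.
set v1 := lam * (b - t); set v2 := lam * (- (1 - b) - t).
transitivity ((1 - b) * (Num.max v1 0 - Num.max (- v1) 0) +
  b * (Num.max v2 0 - Num.max (- v2) 0)); first by ring.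
by rewrite !mm /v1 /v2; ring.
Qed.

(** The shift [tb p b] is the equality case of [two_point_le] with [a = 1 - b]. Positivity of [I1]
    allows cancelling the moment when the best constant is bounded below. *)
Lemma two_point_law_moment_eq X b lam p : 1 < p -> 0 < b < 1 ->
  P.-integrable setT (EFin \o X) ->
  same_law_scaled_twopoint X (1 - b) b lam (tb p b) ->
  let m := fine 'E_P[X]%E in exists I1 I0,
  [/\ (\int[P]_x (`|X x - m| `^ p)%:E = I1%:E)%E,
      (\int[P]_x (`|X x| `^ p)%:E = I0%:E)%E, I1 = Rpb p b * I0 &
      lam != 0 -> 0 < I1].
Proof.
move=> p1 b01 iX law /=; have [-> I] := two_point_law_moments p b01 iX law.
have I0 : (\int[P]_x (`|X x| `^ p)%:E = \int[P]_x (`|X x - 0| `^ p)%:E)%E.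
  by apply: eq_integral => x _; rewrite subr0.
rewrite I0 !I.
eexists; eexists; split; [reflexivity|reflexivity| |].
  have /andP[b0 b1] := b01; have b10 : 0 < 1 - b by rewrite subr_gt0.
  have [_ h] := two_point_le (tb p b) p1 b10 b0.
  move: h; rewrite subrK divr1 mul1r eqxx => /eqP h.
  have n1 : `|lam * (b - tb p b) - - (lam * tb p b)| `^ p = `|lam| `^ p * b `^ p.
    rewrite (_ : _ - _ = lam * b); last by ring.
    by rewrite normrM (gtr0_norm b0) powRM// ltW.
  have n2 : `|lam * (- (1 - b) - tb p b) - - (lam * tb p b)| `^ p = `|lam| `^ p * (1 - b) `^ p.
    rewrite (_ : _ - _ = - (lam * (1 - b))); last by ring.
    by rewrite normrN normrM (gtr0_norm b10) powRM// ltW.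
  have n3 : `|lam * (b - tb p b) - 0| `^ p = `|lam| `^ p * `|b - tb p b| `^ p.
    by rewrite subr0 normrM powRM.
  have n4 : `|lam * (- (1 - b) - tb p b) - 0| `^ p = `|lam| `^ p * `|1 - b + tb p b| `^ p.
    by rewrite subr0 (_ : _ * _ = - (lam * (1 - b + tb p b))) ?normrN ?normrM ?powRM//; ring.
  rewrite -> n1, n2, n3, n4.
  transitivity (`|lam| `^ p * ((1 - b) * b `^ p + b * (1 - b) `^ p)); first by ring.
  by rewrite h; ring.
move=> lam0; case/andP: b01 => b0 b1.
apply: ltr_pwDl; last by rewrite mulr_ge0 ?powR_ge0// ltW.
rewrite mulr_gt0 ?subr_gt0//; apply: powR_gt0; rewrite normr_gt0.
rewrite (_ : _ - _ = lam * b); last by ring.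
by rewrite mulf_neq0// gt_eqF.
Qed.

End laws.

(** * Two-point laws realized on [bool] *)

Section bernoulli_example.
Variable R : realType.

Lemma exists_two_point_law (b lam t : R) : 0 < b < 1 ->
  exists (P : probability bool R) (X : {RV P >-> R}),
    P.-integrable setT (EFin \o X) /\ same_law_scaled_twopoint X (1 - b) b lam t.
Proof.
move=> /andP[b0 b1].
pose f (c : bool) : R := if c then lam * (b - t) else lam * (- (1 - b) - t).
have mf : measurable_fun setT f by [].
pose P : probability bool R := bernoulli_prob (1 - b).
pose X : {RV P >-> R} := mfun_Sub (mem_set mf).
have b01 : 0 <= 1 - b <= 1 by apply/andP; split; lra.
exists P, X; split.
  apply/integrableP; split; first by apply/measurable_EFinP; exact: mf.
  rewrite integral_bernoulli_prob//=.
  by rewrite -!EFinM -EFinD ltry.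
move=> A mA; rewrite subrK !divr1.
have -> : P (X @^-1` A) = bernoulli_prob (1 - b) (f @^-1` A) by [].
rewrite bernoulli_probE// !diracE.
rewrite -!EFinM -EFinD; congr EFin.
rewrite /unstable.onem subKr /indic; congr (_ * _ + _ * _); congr (_%:R); congr nat_of_bool.
Qed.

End bernoulli_example.

Section best_constant.
Variable R : realType.
Implicit Types p b : R.

Lemma Rpb_le_max p b : 1 < p -> 0 <= b <= 1 -> Rpb p b <= Rpb p (bp p).
Proof.
move=> p1; have [_ bmax] := bp_max p1 => /andP[c0 c1]; have [c12|c12] := leP b (1/2).
  by apply: bmax; rewrite c0.
have c' : 0 <= 1 - b <= 1/2 by clear - c0 c1 c12; apply/andP; split; lra.
by have := bmax _ c'; rewrite -> (Rpb_onem p b).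
Qed.

Lemma bp_bnd p : 1 < p -> 0 <= bp p <= 1.
Proof.
move=> p1; have [h _] := bp_max p1; clear - h; case/andP: h => ? ?.
by apply/andP; split; lra.
Qed.

Lemma centering_inequality (d : measure_display) (T : measurableType d)
    (P : probability T R) (X : {RV P >-> R}) p : 1 < p ->
  P.-integrable setT (EFin \o X) ->
  (\int[P]_x (`| X x - fine 'E_P[X] | `^ p)%:E
     <= (Rpb p (bp p))%:E * \int[P]_x (`| X x | `^ p)%:E)%E.
Proof.
move=> p1 iX.
have [k hk] := exists_centering_slope (- fine 'E_P[X]%E) p1 (fun b => @Rpb_le_max p b p1).
apply: (@moment_gap_ge0 _ _ _ P X p _ k p1 iX); first exact: Rpb_gt0 (bp_bnd p1).
by move=> y; have := hk (y - fine 'E_P[X]%E); rewrite opprK subrK.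
Qed.

Lemma CbestE p : 1 < p -> Cbest p = (Rpb p (bp p))%:E.
Proof.
move=> p1; apply/le_anti/andP; split.
  apply: ereal_inf_lbound; split; first by rewrite lee_fin; apply/ltW/Rpb_gt0/bp_bnd.
  by move=> d T P X iX; exact: centering_inequality.
(* At [p = 2] the point [bp p] may be an endpoint, where the two-point law degenerates; an interior
   maximizer is used instead. *)
have [b b12 bmax] := Rpb_max_exists p1.
have le1 : Rpb p (bp p) <= Rpb p b by apply: bmax; exact: bp_bnd.
have b01 : 0 < b < 1 by clear - b12; case/andP: b12 => ? ?; apply/andP; split; lra.
apply: (@le_trans _ _ (Rpb p b)%:E); first by rewrite lee_fin.
apply: le_ereal_inf_tmp => C [C0 hC].
have [P [X [iX law]]] := exists_two_point_law 1 (tb p b) b01.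
have := hC _ _ P X iX.
have [I1 [I0 [-> -> e pos]]] := two_point_law_moment_eq p1 b01 iX law.
have {}pos := pos (oner_neq0 _).
have R0 : 0 < Rpb p b by apply: Rpb_gt0; case/andP: b01 => ? ?; rewrite !ltW.
have I00 : 0 < I0 by move: pos; rewrite e pmulr_rgt0.
case: C C0 {hC} => [C||] C0; rewrite ?leey//.
by rewrite -EFinM !lee_fin e ler_pM2r.
Qed.

Lemma powR2_norm (x : R) : `|x| `^ 2 = x ^+ 2.
Proof. by rewrite -[2]/(2%:R) powR_mulrn// real_normK// num_real. Qed.

Lemma centering_equality (d : measure_display) (T : measurableType d)
    (P : probability T R) (X : {RV P >-> R}) p : 1 < p ->
  P.-integrable setT (EFin \o X) ->
  ((\int[P]_x (`| X x - fine 'E_P[X] | `^ p)%:E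
      = (Rpb p (bp p))%:E * \int[P]_x (`| X x | `^ p)%:E)%E
   <->
   [\/ (\int[P]_x (`| X x | `^ p)%:E = +oo)%E,
       [/\ p = 2, (\int[P]_x ((X x) ^+ 2)%:E < +oo)%E & ('E_P[X] = 0)%E] |
       p != 2 /\ exists lam : R,
         same_law_scaled_twopoint X (1 - bp p) (bp p) lam (tb p (bp p))]).
Proof.
move=> p1 iX; set m := fine 'E_P[X]%E.
have C0 : 0 < Rpb p (bp p) by apply: Rpb_gt0; exact: bp_bnd.
have hk1 : exists k, forall y : R, k * (y - m) <= Rpb p (bp p) * `|y| `^ p - `|y - m| `^ p.
  have [k hk] := exists_centering_slope (- m) p1 (fun b => @Rpb_le_max p b p1).
  by exists k => y; have := hk (y - m); rewrite opprK subrK.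
split; last first.
  case=> [inf|[p2 fin m0]|[p2 [lam law]]].
  - by rewrite inf gt0_muley ?lte_fin//; exact: moment_shift_infty.
  - rewrite /m m0 /= p2 Rpb2 ?mul1e; last by apply: bp_bnd; lra.
    by apply: eq_integral => x _; rewrite subr0.
  - have bI := is_Rpb_max_interior p1 p2 (bp_max p1).
    have b01 : 0 < bp p < 1 by clear - bI; case/andP: bI => ? ?; apply/andP; split; lra.
    have [I1 [I0 [-> -> -> _]]] := two_point_law_moment_eq p1 b01 iX law.
    by rewrite EFinM.
have [inf|] := eqVneq (\int[P]_x (`| X x | `^ p)%:E)%E +oo%E; first by move=> _; constructor 1.
rewrite -ltey => fin.
have [k hk] := hk1.
move=> E; have ae0 := moment_gap_eq0 p1 iX fin hk E.
have [p2|p2] := eqVneq p 2; [constructor 2|constructor 3].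
  have fin2 : (\int[P]_x (X x ^+ 2)%:E < +oo)%E.
    rewrite (_ : (\int[P]_x (X x ^+ 2)%:E)%E = (\int[P]_x (`|X x| `^ p)%:E)%E)//.
    by apply: eq_integral => x _; rewrite p2 powR2_norm.
  split=> //; rewrite (mean_fin iX) -/m; congr EFin.
  (* For [p = 2] the constant is 1, and with slope [2 m] the gap is identically [m^2]; equality then
     forces [m = 0]. *)
  have hk0 (y : R) : (2 * m) * (y - m) <= Rpb p (bp p) * `|y| `^ p - `|y - m| `^ p.
    rewrite p2 Rpb2 ?mul1r; last by apply: bp_bnd; lra.
    by rewrite !powR2_norm -subr_ge0 (_ : _ - _ = m ^+ 2) ?sqr_ge0//; ring.
  have ae2 := moment_gap_eq0 p1 iX fin hk0 E.
  have [[x]|[[x + _] _]] := centered_takes_both_signs iX ae2; rewrite -/m.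
  - rewrite p2 Rpb2 ?mul1r; last by apply: bp_bnd; lra.
    rewrite !powR2_norm => h _; apply/eqP; rewrite -sqrf_eq0; apply/eqP; lra.
  - rewrite p2 Rpb2 ?mul1r; last by apply: bp_bnd; lra.
    rewrite !powR2_norm => h; apply/eqP; rewrite -sqrf_eq0; apply/eqP; lra.
split=> //.
have p0 : p != 0 by rewrite gt_eqF//; lra.
have tb1 : forall A, measurable A -> {ae P, forall x, X x = 0} ->
    P (X @^-1` A) = (\1_A 0)%:E.
  move=> A mA aX.
  have mXA : measurable (X @^-1` A).
    by rewrite -[_ @^-1` _]setTI; exact: (measurable_funP X).
  rewrite -[X @^-1` A]setIT -(integral_indic P measurableT mXA).
  transitivity (\int[P]_x (\1_A 0)%:E)%E; last first.
    by rewrite integral_cst//= probability_setT mule1.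
  apply: ae_eq_integral => //; first by apply/measurable_EFinP; exact: measurable_indic.
  by apply: filterS aX => x /= aX _; rewrite -[0]aX.
(* With zero mean, slope 0 turns the equality into [(C - 1) |X|^p = 0] almost surely. Since [C > 1],
   [X] vanishes almost surely, which is the case [lam = 0]. *)
have [m0|m0] := eqVneq m 0.
  exists 0 => A mA; rewrite !mul0r subrK !divr1 -mulrDl subrK mul1r; apply: tb1 => //.
  have hk0 (y : R) : 0 * (y - m) <= Rpb p (bp p) * `|y| `^ p - `|y - m| `^ p.
    rewrite mul0r m0 subr0 -[X in _ - X]mul1r -mulrBl mulr_ge0 ?powR_ge0//.
    by rewrite subr_ge0; apply: Rpb_ge1 => //; exact: bp_bnd.
  have := moment_gap_eq0 p1 iX fin hk0 E; apply: filterS => x.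
  rewrite -/m mul0r m0 subr0 -[X in _ - X]mul1r -mulrBl => /eqP.
  have bI := is_Rpb_max_interior p1 p2 (bp_max p1).
  have C1 : Rpb p (bp p) - 1 != 0 by rewrite gt_eqF// subr_gt0; exact: Rpb_gt1.
  by rewrite mulf_eq0 (negbTE C1)/= powR_eq0 p0 andbT normr_eq0 => /eqP.
have t0 : - m != 0 by rewrite oppr_eq0.
(* The contact equations at [x] and [y], weighted by [m - y] and [x - m], eliminate [k] and leave
   equality in the two-point inequality with [t = - m]. *)
have contact x y : m < x -> y < m ->
    Rpb p (bp p) * `|x| `^ p - `|x - m| `^ p = k * (x - m) ->
    Rpb p (bp p) * `|y| `^ p - `|y - m| `^ p = k * (y - m) ->
   (m - y) * (x - m) `^ p + (x - m) * (m - y) `^ p =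
   Rpb p (bp p) * ((m - y) * `|x - m - - m| `^ p + (x - m) * `|m - y + - m| `^ p).
  move=> mx ym ex ey.
  rewrite (_ : x - m - - m = x); last by ring.
  rewrite (_ : m - y + - m = - y); last by ring.
  rewrite normrN; move: ex ey.
  rewrite (gtr0_norm (_ : 0 < x - m)) ?subr_gt0//.
  rewrite (ltr0_norm (_ : y - m < 0)) ?subr_lt0// opprB.
  set C := Rpb p (bp p); set A := `|x| `^ p; set B := `|y| `^ p.
  set D := (x - m) `^ p; set F := (m - y) `^ p => ex ey.
  have -> : D = C * A - k * (x - m) by rewrite -ex; ring.
  have -> : F = C * B - k * (y - m) by rewrite -ey; ring.
  by ring.
(* A contact point with [X x = m] would give [C |m|^p = 0], against [m != 0]. *)
have [[x ex xm]|[[x ex mx] [y ey ym]]] := centered_takes_both_signs iX ae0.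
  move: ex; rewrite -/m xm subrr normr0 powR0// subr0 mulr0 => /eqP.
  by rewrite mulf_eq0 gt_eqF//= powR_eq0 normr_eq0 (negbTE m0).
have E1 := contact _ _ mx ym ex ey.
have mx0 : 0 < X x - m by rewrite subr_gt0.
have ym0 : 0 < m - X y by rewrite subr_gt0.
(* Comparing the pair with itself yields the scale [l]. *)
have [_ [l l0 [tl cases]]] := two_point_eq_uniq p1 p2 t0 erefl ym0 mx0 ym0 mx0 E1 E1.
(* A third contact point is paired with the known one on the other side of [m]; uniqueness of the
   pair identifies it with the known one on its own side. *)
have two : {ae P, forall z, X z = X x \/ X z = X y}.
  apply: filterS ae0 => z ez; have [mz|mz|mz] := ltgtP m (X z).
  - left; have E2 := contact _ _ mz ym ez ey.
    have mz0 : 0 < X z - m by rewrite subr_gt0.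
    have [[_ h] _] := two_point_eq_uniq p1 p2 t0 erefl ym0 mx0 ym0 mz0 E1 E2.
    by move: h; clear; lra.
  - right; have E2 := contact _ _ mx mz ex ez.
    have mz0 : 0 < m - X z by rewrite subr_gt0.
    have [[h _] _] := two_point_eq_uniq p1 p2 t0 erefl ym0 mx0 mz0 mx0 E1 E2.
    by move: h; clear; lra.
  - exfalso; move: ez; rewrite -mz subrr normr0 powR0// subr0 mulr0 => /eqP.
    by rewrite mulf_eq0 gt_eqF//= powR_eq0 normr_eq0 (negbTE m0).
exists l => A mA.
have mE : m = - (l * tb p (bp p)) by rewrite -tl opprK.
have nxy : X x != X y by rewrite gt_eqF//; exact: lt_trans mx.
rewrite subrK !divr1.
case: cases => -[ex1 ey1].
- have xE : X x = l * (bp p - tb p (bp p)) by rewrite -(subrK m (X x)) ex1 mE; ring.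
  have yE : X y = l * (- (1 - bp p) - tb p (bp p)).
    by rewrite -(subKr m (X y)) ey1 mE; ring.
  rewrite -xE -yE; apply: (ae_two_valued_law iX) => //; first by rewrite subrK.
  by rewrite -/m xE yE mE; ring.
- have yE : X y = l * (bp p - tb p (bp p)).
    by rewrite -(subKr m (X y)) ey1 mE; ring.
  have xE : X x = l * (- (1 - bp p) - tb p (bp p)).
    by rewrite -(subrK m (X x)) ex1 mE; ring.
  rewrite -xE -yE.
  apply: (@ae_two_valued_law _ _ _ P X (X y) (X x) (1 - bp p) (bp p) iX) => //.
  + by rewrite eq_sym.
  + by rewrite subrK.
  + by rewrite -/m xE yE mE; ring.
  by apply: filterS two => z [->|->]; [right|left].
Qed.

End best_constant.

(** * Dependence on the exponent *)

Section convexity.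
Variable R : realType.
Implicit Types p x y t b : R.

(** Two chords bound the increment: [x + s h] lies between [x] and [x + s e], and [x] lies between
    [x - s e] and [x + s h]. The sign [s] treats both sides of [x] at once. *)
Lemma convex_ray_lipschitz (f : R -> R) (a x s h e : R) :
  (forall x y t, a < x -> a < y -> x != y -> 0 < t < 1 ->
     f (t * x + (1 - t) * y) <= t * f x + (1 - t) * f y) ->
  a < x - `|s * e| -> s != 0 -> 0 < h < e ->
  `|f (x + s * h) - f x| * e <= h * (`|f (x + s * e) - f x| + `|f (x - s * e) - f x|).
Proof.
move=> cf; rewrite ltrBrDl => ax s0 /andP[h0 he].
have e0 : 0 < e by exact: lt_trans he.
have ep : 0 < e + h by rewrite addr_gt0.
have n1 := ler_norm (s * e); have n2 := ler_norm (- (s * e)); rewrite normrN in n2.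
have sh : `|s * h| <= `|s * e|.
  by rewrite !normrM ler_wpM2l// (gtr0_norm h0) (gtr0_norm e0) ltW.
have n3 := ler_norm (- (s * h)); rewrite normrN in n3.
have h1 : f (x + s * h) <= (h / e) * f (x + s * e) + (1 - h / e) * f x.
  rewrite (_ : x + s * h = (h / e) * (x + s * e) + (1 - h / e) * x); last first.
    by field; rewrite gt_eqF.
  apply: cf; [lra|have := normr_ge0 (s * e); lra| |].
    rewrite -subr_eq0 (_ : _ - _ = s * e); last by ring.
    by rewrite mulf_neq0// gt_eqF.
  by rewrite divr_gt0//= ltr_pdivrMr// mul1r.
have h2 : f x <= (e / (e + h)) * f (x + s * h) + (1 - e / (e + h)) * f (x - s * e).
  rewrite {1}(_ : x = (e / (e + h)) * (x + s * h) + (1 - e / (e + h)) * (x - s * e)); last first.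
    by field; rewrite gt_eqF.
  apply: cf; [lra|lra| |].
    rewrite -subr_eq0 (_ : _ - _ = s * (e + h)); last by ring.
    by rewrite mulf_neq0// gt_eqF.
  by rewrite divr_gt0//= ltr_pdivrMr// mul1r; lra.
have h1' : e * (f (x + s * h) - f x) <= h * (f (x + s * e) - f x).
  move: h1; rewrite -(ler_pM2l e0) => h1.
  have -> : h * (f (x + s * e) - f x) = e * (h / e * f (x + s * e) + (1 - h / e) * f x) - e * f x.
    by field; rewrite gt_eqF.
  by rewrite mulrBr lerB.
have h2' : - (h * (f (x - s * e) - f x)) <= e * (f (x + s * h) - f x).
  move: h2; rewrite -(ler_pM2l ep) => h2.
  have : (e + h) * f x <= e * f (x + s * h) + h * f (x - s * e).
    apply: le_trans h2 _; rewrite le_eqVlt; apply/orP; left; apply/eqP.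
    by field; rewrite gt_eqF.
  by rewrite mulrDl !mulrBr; lra.
rewrite -{1}(gtr0_norm e0) -normrM mulrC ler_norml; apply/andP; split.
  apply: le_trans h2'; rewrite lerN2 ler_pM2l//.
  by rewrite (le_trans (ler_norm _))// lerDr.
apply: le_trans h1' _; rewrite ler_pM2l//.
by rewrite (le_trans (ler_norm _))// lerDl.
Qed.

Lemma convex_ray_continuous (f : R -> R) (a x : R) :
  (forall x y t, a < x -> a < y -> x != y -> 0 < t < 1 ->
     f (t * x + (1 - t) * y) <= t * f x + (1 - t) * f y) ->
  a < x -> {for x, continuous f}.
Proof.
move=> cf ax; pose e := (x - a) / 2.
have e0 : 0 < e by rewrite divr_gt0// subr_gt0.
pose K : R := `|f (x + e) - f x| + `|f (x - e) - f x|.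
have K0 : 0 <= K by rewrite addr_ge0.
have lip y : `|y - x| < e -> `|f y - f x| * e <= `|y - x| * K.
  move=> ye; have [yx|yx|->] := ltgtP x y; last by rewrite !subrr normr0 !mul0r.
  - have := @convex_ray_lipschitz f a x 1 (y - x) e cf.
    rewrite !mul1r oner_eq0 (gtr0_norm e0) (_ : x + (y - x) = y); last by ring.
    rewrite (gtr0_norm (_ : 0 < y - x)) ?subr_gt0// in ye *.
    apply=> //; [rewrite /e; lra|by rewrite yx ye].
  - have := @convex_ray_lipschitz f a x (-1) (x - y) e cf.
    rewrite !mulN1r oppr_eq0 oner_eq0 normrN (gtr0_norm e0).
    rewrite (_ : x + - (x - y) = y) ?opprK; last by ring.
    rewrite (distrC y) (gtr0_norm (_ : 0 < x - y)) ?subr_gt0// in ye *.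
    rewrite /K (addrC `|f (x + e) - f x|); apply=> //; [rewrite /e; lra|by rewrite yx ye].
apply/cvgrPdist_lt => eps eps0.
pose dl := Num.min e (eps * e / (K + 1)).
have K1 : 0 < K + 1 by rewrite ltr_wpDl.
have dl0 : 0 < dl by rewrite lt_min e0/=; apply: divr_gt0 => //; exact: mulr_gt0.
exists dl; first exact: dl0.
move=> y; rewrite /ball_/= distrC => yd.
move: yd; rewrite lt_min => /andP[y1 y2].
rewrite distrC -(ltr_pM2r e0); apply: le_lt_trans (lip _ y1) _.
rewrite ltr_pdivlMr// in y2; apply: le_lt_trans y2.
by rewrite ler_wpM2l// lerDl.
Qed.

Definition Cmax p : R := Rpb p (bp p).

Lemma fine_Cbest p : 1 < p -> fine (Cbest p) = Cmax p.
Proof. by move=> p1; rewrite CbestE. Qed.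

Lemma Cmax_gt0 p : 1 < p -> 0 < Cmax p.
Proof. by move=> p1; apply/Rpb_gt0/bp_bnd. Qed.

Lemma Cmax_ge p b : 1 < p -> 0 <= b <= 1 -> Rpb p b <= Cmax p.
Proof. exact: Rpb_le_max. Qed.

Lemma Cmax_attained p : 1 < p -> exists2 b, 0 < b < 1/2 & Cmax p = Rpb p b.
Proof.
move=> p1; have [b b12 bmax] := Rpb_max_exists p1; exists b; first exact: b12.
apply/le_anti/andP; split; first by apply: bmax; exact: bp_bnd.
by apply: Cmax_ge => //; clear - b12; case/andP: b12 => ? ?; apply/andP; split; lra.
Qed.

(** A supremum of strictly convex functions is in general only convex. Strictness survives because
    at the intermediate exponent the supremum is attained at some [b] in [(0, 1/2)]. *)
Lemma ltr_ln_Cmax x y t : 1 < x -> 1 < y -> x != y -> 0 < t < 1 ->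
  ln (Cmax (t * x + (1 - t) * y)) < t * ln (Cmax x) + (1 - t) * ln (Cmax y).
Proof.
move=> x1 y1 xy t01; case/andP: (t01) => t0 t1.
have z1 : 1 < t * x + (1 - t) * y.
  rewrite [X in X < _](_ : _ = t * 1 + (1 - t) * 1); last by ring.
  by rewrite ltrD// ltr_pM2l// subr_gt0.
have [b b12 ->] := Cmax_attained z1.
have b01 : 0 <= b <= 1 by clear - b12; case/andP: b12 => ? ?; apply/andP; split; lra.
apply: lt_le_trans (ltr_ln_Rpb x1 y1 xy t01 b12) _.
have t1' : 0 <= 1 - t by rewrite subr_ge0 ltW.
apply: lerD.
  apply: ler_wpM2l; first exact: ltW.
  by rewrite ler_ln; [exact: Cmax_ge|exact: Rpb_gt0|exact: Cmax_gt0].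
apply: ler_wpM2l; first exact: t1'.
by rewrite ler_ln; [exact: Cmax_ge|exact: Rpb_gt0|exact: Cmax_gt0].
Qed.

Lemma Cmax2 : Cmax 2 = 1.
Proof. by rewrite /Cmax Rpb2//; apply: bp_bnd; lra. Qed.

Lemma Cmax_gt1 p : 1 < p -> p != 2 -> 1 < Cmax p.
Proof.
by move=> p1 p2; apply: Rpb_gt1 => //; exact: is_Rpb_max_interior (bp_max p1).
Qed.

Lemma ln_Cmax_gt0 p : 1 < p -> p != 2 -> 0 < ln (Cmax p).
Proof. by move=> p1 p2; apply: ln_gt0; exact: Cmax_gt1. Qed.

Lemma ln_Cmax_toward2 p t : 1 < p -> p != 2 -> 0 < t < 1 ->
  ln (Cmax (t * p + (1 - t) * 2)) < t * ln (Cmax p).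
Proof.
move=> p1 p2 t01; have two1 : 1 < 2 :> R by lra.
have := ltr_ln_Cmax p1 two1 p2 t01.
by rewrite Cmax2 ln1 mulr0 addr0.
Qed.

Lemma Cmax_mono_toward2 p t : 1 < p -> p != 2 -> 0 <= t < 1 ->
  Cmax (t * p + (1 - t) * 2) < Cmax p.
Proof.
move=> p1 p2 /andP[]; rewrite le_eqVlt => /predU1P[<- _|t0 t1].
  by rewrite mul0r add0r subr0 mul1r Cmax2; exact: Cmax_gt1.
have t01 : 0 < t < 1 by rewrite t0.
have z1 : 1 < t * p + (1 - t) * 2.
  rewrite [X in X < _](_ : _ = t * 1 + (1 - t) * 1); last by ring.
  by rewrite ltrD// ltr_pM2l ?subr_gt0//; lra.
have := ln_Cmax_toward2 p1 p2 t01 => h.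
have l0 := ln_Cmax_gt0 p1 p2.
rewrite -ltr_ln ?posrE ?Cmax_gt0//.
by apply: lt_le_trans h _; rewrite ler_piMl ?ltW.
Qed.

Lemma Cmax_decr x y : 1 < x -> x < y -> y <= 2 -> Cmax y < Cmax x.
Proof.
move=> x1 xy y2; have x2 : 0 < 2 - x by lra.
have xn : x != 2 by rewrite lt_eqF//; lra.
rewrite [in X in X < _](_ : y = (2 - y) / (2 - x) * x + (1 - (2 - y) / (2 - x)) * 2).
  apply: Cmax_mono_toward2 => //; rewrite divr_ge0 ?subr_ge0 ?(ltW x2)//=.
    by rewrite ltr_pdivrMr//; lra.
  by lra.
by field; rewrite gt_eqF.
Qed.

Lemma Cmax_incr x y : 2 <= x -> x < y -> Cmax x < Cmax y.
Proof.
move=> x2 xy; have y2 : 0 < y - 2 by lra.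
have yn : y != 2 by rewrite gt_eqF//; lra.
rewrite [in X in X < _](_ : x = (x - 2) / (y - 2) * y + (1 - (x - 2) / (y - 2)) * 2).
  apply: Cmax_mono_toward2 => //; first by lra.
  apply/andP; split; first by rewrite divr_ge0 ?(ltW y2)// subr_ge0.
  by rewrite ltr_pdivrMr//; lra.
by field; rewrite gt_eqF.
Qed.

(** Convexity of [ln Cmax], which vanishes at 2, makes it at least [(p - 2) ln (Cmax 3)] beyond 3;
    then [e^x >= 1 + x]. This yields divergence at infinity. *)
Lemma Cmax_ge_linear p : 3 < p -> 1 + (p - 2) * ln (Cmax 3) <= Cmax p.
Proof.
move=> p3; have p2 : 0 < p - 2 by lra.
have p1 : 1 < p by lra.
have pn : p != 2 by rewrite gt_eqF//; lra.
have t01 : 0 < (p - 2)^-1 < 1 by rewrite invr_gt0 p2/= invf_lt1//; lra.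
have := ln_Cmax_toward2 p1 pn t01.
rewrite (_ : _ + _ = 3); last by field; rewrite gt_eqF.
rewrite mulrC ltr_pdivlMr// => h.
have -> : Cmax p = expR (ln (Cmax p)) by rewrite lnK ?posrE ?Cmax_gt0.
apply: le_trans (expR_ge1Dx _).
by rewrite lerD2l mulrC ltW.
Qed.

Lemma Cmax_conj p : 1 < p -> Cmax (p / (p - 1)) = Cmax p `^ (1 / (p - 1)).
Proof. by move=> p1; rewrite /Cmax bp_conj// Rpb_conj//; exact: bp_bnd. Qed.

Lemma Cmax_conj_sqrt p : 1 < p -> Cmax p `^ (1 / Num.sqrt (p - 1)) =
  Cmax (p / (p - 1)) `^ (1 / Num.sqrt (p / (p - 1) - 1)).
Proof.
move=> p1; have r0 : 0 < p - 1 by lra.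
rewrite (Cmax_conj p1) -powRrM (conj_subr1 p1) !div1r sqrtrV ?ltW// invrK.
congr (_ `^ _); have s0 : Num.sqrt (p - 1) != 0 by rewrite gt_eqF// sqrtr_gt0.
rewrite -[in X in _ = X * _](sqr_sqrtr (ltW r0)) expr2.
by field.
Qed.

Lemma cvg_Cmax_pinfty : Cmax p @[p --> +oo] --> +oo.
Proof.
have k0 : 0 < ln (Cmax 3) by apply: ln_Cmax_gt0; [lra|rewrite gt_eqF//; lra].
apply/cvgryPge => A; near=> p.
have p3 : 3 < p by near: p; exact: nbhs_pinfty_gt.
have pA : 2 + `|A| / ln (Cmax 3) < p by near: p; apply: nbhs_pinfty_gt; rewrite num_real.
apply: le_trans (Cmax_ge_linear p3).
apply: le_trans (ler_norm A) _; rewrite -ltrBrDl ltr_pdivrMr// in pA.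
by move: pA; move/ltW/le_trans; apply; rewrite lerDr.
Unshelve. all: by end_near. Qed.

(** In the first factor each power is at most 1; in the second the exponent [1 / (p - 1)] is at
    least 1, so the sum is at most [b + (1 - b)]. *)
Lemma Cmax_le2 p : 1 < p -> p < 2 -> Cmax p <= 2.
Proof.
move=> p1 p2; have [b b12 ->] := Cmax_attained p1.
have [b0 b1] : 0 < b /\ 0 < 1 - b by clear - b12; case/andP: b12 => ? ?; split; lra.
have b1' : b <= 1 by rewrite -subr_ge0 ltW.
have r0 : 0 < p - 1 by lra.
have s1 : 1 <= 1 / (p - 1) by rewrite ler_pdivlMr// mul1r; lra.
have h1 : powsum (p - 1) b <= 2.
  have e : 2 = 1 + 1 :> R by ring.
  rewrite e /powsum lerD//; apply: powR_le1; rewrite ?(ltW r0) ?(ltW b0) ?(ltW b1)//=.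
  by rewrite lerBlDr lerDl ltW.
have h2 : powsum (1 / (p - 1)) b `^ (p - 1) <= 1.
  apply: powR_le1; last exact: ltW.
  apply/andP; split; first by apply: addr_ge0; exact: powR_ge0.
  have hb : b `^ (1 / (p - 1)) <= b by apply: ge1r_powR; rewrite ?b0.
  have hc : (1 - b) `^ (1 / (p - 1)) <= 1 - b.
    by apply: ge1r_powR; rewrite // b1/= lerBlDr lerDl ltW.
  by have := lerD hb hc; rewrite (_ : b + (1 - b) = 1)//; ring.
rewrite RpbE; have -> : 2 = 2 * 1 :> R by ring.
apply: ler_pM => //; last exact: powR_ge0.
by apply: addr_ge0; exact: powR_ge0.
Qed.

(** Both terms of the first factor are at least [b^(p - 1)]; in the second only the term in [1 - b]
    is kept, and its exponents cancel. *)
Lemma Cmax_lower1 p b : 1 < p -> 0 < b < 1/2 -> 2 * (1 - b) * b `^ (p - 1) <= Cmax p.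
Proof.
move=> p1 b12.
have [b0 b1] : 0 < b /\ 0 < 1 - b by clear - b12; case/andP: b12 => ? ?; split; lra.
have bb : b <= 1 - b by clear - b12; case/andP: b12 => ? ?; lra.
have r0 : 0 < p - 1 by lra.
have b01 : 0 <= b <= 1 by rewrite ltW//= -subr_ge0 ltW.
apply: le_trans (Cmax_ge p1 b01); rewrite RpbE.
rewrite [leLHS](_ : _ = (2 * b `^ (p - 1)) * (1 - b)); last by ring.
apply: ler_pM; [by rewrite mulr_ge0// powR_ge0|exact: ltW| |].
  rewrite /powsum mulr_natl mulr2n lerD2l.
  by apply: ge0_ler_powR; rewrite ?nnegrE ?(ltW r0) ?(ltW b0) ?(ltW b1).
rewrite -{1}(conj_expK p1 (ltW b1)).
apply: ge0_ler_powR; rewrite ?nnegrE ?(ltW r0) ?powR_ge0//.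
  by apply: addr_ge0; exact: powR_ge0.
by rewrite /powsum lerDr powR_ge0.
Qed.

Lemma cvg_Cmax_1 : Cmax p @[p --> 1^'+] --> (2 : R).
Proof.
apply/cvgrPdist_lt => e e0.
(* As [p] tends to 1 the lower bound tends to [2 (1 - b) >= 2 - e / 4], leaving room for an error
   [e / 2]. *)
pose b : R := Num.min (e / 8) (1/4).
have b0 : 0 < b by rewrite lt_min; apply/andP; split; lra.
have be : b <= e / 8 by rewrite ge_min lexx.
have b4 : b <= 1/4 by rewrite ge_min lexx orbT.
have b12 : 0 < b < 1/2 by apply/andP; split; lra.
have cv : 2 * (1 - b) * b `^ (p - 1) @[p --> 1^'+] --> 2 * (1 - b).
  rewrite -[X in _ --> X]mulr1; apply: cvgM; first exact: cvg_cst.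
  rewrite (_ : (fun p => b `^ (p - 1)) = (fun p => expR ((p - 1) * ln b))); last first.
    by apply/funext => p; rewrite /powR gt_eqF.
  apply: cvg_at_right_filter.
  have : {for 1, continuous (fun p : R => expR ((p - 1) * ln b))}.
    apply: (@continuous_comp _ _ _ (fun p : R => (p - 1) * ln b) expR); last exact: continuous_expR.
    apply: continuousM; last exact: cst_continuous.
    by apply: continuousB; [exact: cvg_id|exact: cst_continuous].
  by rewrite /prop_for /continuous_at subrr mul0r expR0.
near=> p.
have p1 : 1 < p by near: p; exact: nbhs_right_gt.
have p2 : p < 2 by near: p; apply: nbhs_right_lt; lra.
have h : 2 * (1 - b) - e / 2 < 2 * (1 - b) * b `^ (p - 1).
  by near: p; apply: (cvgr_gt _ cv); lra.
have h1 := Cmax_le2 p1 p2; have h2 := Cmax_lower1 p1 b12.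
rewrite ger0_norm ?subr_ge0//.
have {}h := lt_le_trans h h2.
clear - h be e0; lra.
Unshelve. all: by end_near. Qed.

Lemma continuous_fine_Cbest x : 1 < x -> {for x, continuous (fun p : R => fine (Cbest p))}.
Proof.
move=> x1.
have cl : {for x, continuous (fun p => ln (Cmax p))}.
  apply: (@convex_ray_continuous _ 1) => // u v t u1 v1 uv t01.
  exact/ltW/ltr_ln_Cmax.
have ce : {for x, continuous (fun p => expR (ln (Cmax p)))}.
  apply: (@continuous_comp _ _ _ (fun p => ln (Cmax p)) expR) => //.
  exact: continuous_expR.
have e p : 1 < p -> fine (Cbest p) = expR (ln (Cmax p)).
  by move=> p1; exact (etrans (fine_Cbest p1) (esym (lnK (Cmax_gt0 p1)))).
rewrite /prop_for /continuous_at; rewrite -> (e x x1).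
apply: cvg_trans ce; apply: near_eq_cvg; near=> p.
have p1 : 1 < p by near: p; exact: lt_nbhsr.
exact (esym (e p p1)).
Unshelve. all: by end_near. Qed.

End convexity.

(** * Asymptotics *)

Section asymptotics.
Variable R : realType.
Implicit Types p r x z b u v : R.

(** From [e^y <= 1 / (1 - y)] the sum is at most [2 / (1 - x^2)], and [1 / (1 - x^2) <= 1 + 2 x^2]
    when [x^2 <= 1/2]. *)
Lemma cosh_le_expR x : x ^+ 2 <= 1/2 -> expR x + expR (- x) <= 2 * expR (2 * x ^+ 2).
Proof.
move=> x2.
have x1 : `|x| < 1 by rewrite -(@ltr_pXn2r _ 2)// ?nnegrE// expr1n real_normK ?num_real//; lra.
move: x1; rewrite ltr_norml => /andP[xm xp].
have bnd (y : R) : y < 1 -> expR y <= (1 - y)^-1.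
  move=> y1; rewrite -[y in expR y]opprK expRN lef_pV2 ?posrE ?expR_gt0 ?subr_gt0//.
  by exact: expR_ge1Dx.
have h1 := bnd x xp; have h2 : expR (- x) <= (1 + x)^-1.
  by have := bnd (- x); rewrite opprK; apply; lra.
have p1 : 0 < 1 - x by lra.
have p2 : 0 < 1 + x by lra.
have q0 : 0 < 1 - x ^+ 2 by lra.
have e1 : (1 - x)^-1 + (1 + x)^-1 = 2 * (1 - x ^+ 2)^-1.
  by field; rewrite !gt_eqF.
have e2 : (1 - x ^+ 2)^-1 <= 1 + 2 * x ^+ 2.
  rewrite -[_^-1]mul1r ler_pdivrMr//; set z := x ^+ 2 in x2 q0 *.
  have z0 : 0 <= z by exact: sqr_ge0.
  by rewrite -subr_ge0 (_ : _ - _ = z * (1 - 2 * z)); [rewrite mulr_ge0//; lra|ring].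
have e3 := expR_ge1Dx (2 * x ^+ 2).
lra.
Qed.

Lemma cosh_ge2 x : 2 <= expR x + expR (- x).
Proof. by have := expR_ge1Dx x; have := expR_ge1Dx (- x); lra. Qed.

Lemma sum_expR_factor r u v : r != 0 ->
  expR (u / r) + expR (v / r) =
  expR ((u + v) / (2 * r)) * (expR ((v - u) / (2 * r)) + expR (- ((v - u) / (2 * r)))).
Proof.
by move=> r0; rewrite mulrDr -!expRD addrC; congr (expR _ + expR _); field.
Qed.

(** Factoring out the geometric mean leaves [(2 cosh x)^r] with [x = (v - u) / (2 r)]. For
    [u = ln b] and [v = ln (1 - b)] the left side is the second factor of [R]. *)
Lemma pow_sum_expR_le r u v : 0 < r -> ((v - u) / (2 * r)) ^+ 2 <= 1/2 ->
  (expR (u / r) + expR (v / r)) `^ r <=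
  2 `^ r * expR ((u + v) / 2) * expR ((v - u) ^+ 2 / (2 * r)).
Proof.
move=> r0 h; have rn : r != 0 by rewrite gt_eqF.
rewrite (sum_expR_factor _ _ rn); have := cosh_le_expR h.
set x := (v - u) / (2 * r) => hx.
apply: (@le_trans _ _ ((expR ((u + v) / (2 * r)) * (2 * expR (2 * x ^+ 2))) `^ r)).
  by apply: ge0_ler_powR; rewrite ?nnegrE ?(ltW r0)// ler_wpM2l ?expR_ge0.
rewrite powRM ?expR_ge0 ?mulr_ge0 ?expR_ge0// powRM ?expR_ge0// -!expRM.
rewrite mulrCA mulrA le_eqVlt; apply/orP; left; apply/eqP.
by congr (_ * expR _ * expR _); rewrite /x; field.
Qed.

Lemma pow_sum_expR_ge r u v : 0 < r ->
  2 `^ r * expR ((u + v) / 2) <= (expR (u / r) + expR (v / r)) `^ r.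
Proof.
move=> r0; have rn : r != 0 by rewrite gt_eqF.
rewrite (sum_expR_factor _ _ rn).
have -> : 2 `^ r * expR ((u + v) / 2) = (expR ((u + v) / (2 * r)) * 2) `^ r.
  rewrite powRM ?expR_ge0// -expRM mulrC; congr (expR _ * _); by field.
by apply: ge0_ler_powR; rewrite ?nnegrE ?(ltW r0)// ler_wpM2l ?expR_ge0// cosh_ge2.
Qed.

Lemma powR_expR_div b r : 0 < b -> b `^ (1 / r) = expR (ln b / r).
Proof. by move=> b0; rewrite /powR gt_eqF// mulrAC mul1r mulrC. Qed.

Lemma ler_of_sqr x z : 0 <= z -> x ^+ 2 <= z ^+ 2 -> x <= z.
Proof.
move=> z0 h; apply: le_trans (ler_norm x) _.
by rewrite -(@ler_pXn2r _ 2)// ?nnegrE// real_normK ?num_real.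
Qed.

(** From [e^(-1/16) >= 15/16] one gets [e^(1/2) <= (16/15)^8 <= 1.73], and [1.73^2 < 3]. *)
Lemma expR1_le3 : expR 1 <= 3 :> R.
Proof.
have h : expR (1/2 : R) <= 1 + 1/2 + 1/4 - 1/50.
  have a0 := expR_ge1Dx (- (1/16) : R).
  have -> : (1/2 : R) = - ((8%:R) * - (1/16)) by lra.
  rewrite expRN expRM_natl -[leRHS]invrK lef_pV2 ?posrE ?exprn_gt0 ?expR_gt0 ?invr_gt0//; last by lra.
  apply: (@le_trans _ _ ((15/16) ^+ 8)); last first.
    by apply: lerXn2r; rewrite ?nnegrE ?expR_ge0//; lra.
  by rewrite -[leLHS]mul1r ler_pdivrMr; lra.
have -> : (1 : R) = 2%:R * (1/2) by lra.
rewrite expRM_natl; apply: (@le_trans _ _ ((1 + 1/2 + 1/4 - 1/50) ^+ 2)).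
  by apply: lerXn2r; rewrite ?nnegrE ?expR_ge0//; lra.
by lra.
Qed.

(** This is [x e^(1 - x) <= 1] at [x = 2 r b], with equality at [b = 1 / (2 r)]. *)
Lemma sqrt_mul_expRN_le r b : 0 < r -> 0 < b ->
  2 * expR 1 * r * b * expR (- (2 * r * b)) <= 1.
Proof.
move=> r0 b0; have := expR_ge1Dx (2 * r * b - 1).
rewrite (_ : 1 + (2 * r * b - 1) = 2 * r * b); last by ring.
rewrite expRB => h.
rewrite expRN ler_pdivrMr ?expR_gt0// mul1r.
by move: h; rewrite ler_pdivlMr ?expR_gt0//; rewrite -!mulrA (mulrC (expR 1)) !mulrA => h; lra.
Qed.

(** * Explicit bounds on [R(p, b)] for large [p] *)

Section bounds.
Variables p b : R.
Let r := p - 1.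
Let z := ln r.
(** The factor [1/2] replaces [2^p] by [2^r]: the normalized quantity is [R W / 2^r]. *)
Let W := Num.sqrt (8 * expR 1 * p) / 2.
(** In the window [v - u <= 3 z] the correction is [(3 z)^2 / (2 r) = (9/2) z^2 / r], and
    [z^2 / r <= 6 / z]. *)
Let E := expR (27 / z).
(** From [W <= 4 r] and [e^x >= x^2 / 2] at [x = r ln 2]: this bounds [W 2^(- r)] by [c1 / r]. *)
Let c1 := 8 / ln 2 ^+ 2 : R.

Lemma half_sqrt_sqr : 0 < p -> W ^+ 2 = 2 * expR 1 * p.
Proof.
move=> p0; rewrite exprMn sqr_sqrtr; last by rewrite !mulr_ge0 ?expR_ge0// ltW.
by field.
Qed.

Lemma half_sqrt_ge0 : 0 <= W.
Proof. by rewrite divr_ge0// sqrtr_ge0. Qed.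

Hypothesis z5 : 5 <= z.

Let r0 : 0 < r.
Proof.
have z0 : 0 < z by exact: lt_le_trans z5.
by rewrite ltNge; apply/negP => h; move: z0; rewrite ltNge /z ln_le0// (le_trans h).
Qed.

Let z0 : 0 < z. Proof. by exact: lt_le_trans z5. Qed.

Let rE : r = expR z. Proof. by rewrite lnK. Qed.

Let rz3 : z ^+ 3 / 6 <= r.
Proof.
have := expR_ge1Dxn 2 (ltW z0); rewrite -rE => h.
apply: le_trans h; rewrite (_ : 3`!%:R = 6) // ; lra.
Qed.

Let r20 : 20 <= r.
Proof.
apply: le_trans rz3; rewrite ler_pdivlMr//.
apply: (@le_trans _ _ (5 ^+ 3)); first by lra.
by apply: lerXn2r; rewrite ?nnegrE ?(ltW z0).
Qed.

Let z2r : z ^+ 2 / r <= 6 / z.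
Proof.
rewrite ler_pdivrMr// mulrAC ler_pdivlMr//.
by have := rz3; rewrite exprS; lra.
Qed.

Let zr : z / r <= 1/3.
Proof.
have : z * (z / r) <= z * (1/3); last by rewrite ler_pM2l.
rewrite mulrA -expr2; apply: le_trans z2r _.
rewrite ler_pdivrMr//; apply: (@le_trans _ _ (5 * (1/3) * 5)); first by lra.
by apply: ler_pM => //; rewrite ?ler_pM2r//; lra.
Qed.

Lemma pow_sum_window (u v : R) : 0 <= v - u <= 3 * z ->
  (expR (u / r) + expR (v / r)) `^ r <= 2 `^ r * expR ((u + v) / 2) * E.
Proof.
move=> /andP[d0 d3].
have h : ((v - u) / (2 * r)) ^+ 2 <= 1/2.
  have x0 : 0 <= (v - u) / (2 * r) by rewrite divr_ge0// mulr_ge0// ltW.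
  have x1 : (v - u) / (2 * r) <= 1/2.
    rewrite ler_pdivrMr ?mulr_gt0//; apply: le_trans d3 _.
    by have := zr; rewrite ler_pdivrMr//; lra.
  apply: (@le_trans _ _ ((1/2) ^+ 2)); last by lra.
  by apply: lerXn2r => //; rewrite nnegrE; lra.
apply: le_trans (pow_sum_expR_le r0 h) _.
rewrite ler_wpM2l ?mulr_ge0 ?powR_ge0 ?expR_ge0// ler_expR.
apply: (@le_trans _ _ ((3 * z) ^+ 2 / (2 * r))).
  rewrite ler_pM2r ?invr_gt0 ?mulr_gt0//.
  by apply: lerXn2r => //; rewrite nnegrE mulr_ge0// ltW.
rewrite (_ : (3 * z) ^+ 2 / (2 * r) = 9 / 2 * (z ^+ 2 / r)); last by field; rewrite gt_eqF.
rewrite (_ : 27 / z = 9 / 2 * (6 / z)); last by field; rewrite gt_eqF.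
by rewrite ler_pM2l.
Qed.

Let p0 : 0 < p. Proof. by have := r20; rewrite /r; lra. Qed.

Let W2 : W ^+ 2 <= 12 * r.
Proof.
rewrite half_sqrt_sqr ?p0//.
apply: (@le_trans _ _ (2 * 3 * p)).
  by rewrite ler_pM2r ?p0// ler_pM2l// expR1_le3.
by have := r20; rewrite /r; lra.
Qed.

Let Wr : W <= 4 * r.
Proof.
apply: ler_of_sqr; first by rewrite mulr_ge0// ltW.
apply: le_trans W2 _; rewrite exprMn (_ : 4 ^+ 2 * r ^+ 2 = (16 * r) * r); last by ring.
by rewrite ler_pM2r//; have := r20; lra.
Qed.

Let W2r : W * expR (- (r * ln 2)) <= c1 / r.
Proof.
have l20 : 0 < ln 2 :> R by rewrite ln_gt0//; lra.
have y0 : 0 < r * ln 2 by rewrite mulr_gt0.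
have := expR_ge1Dxn 1 (ltW y0); rewrite (_ : 2`!%:R = 2)// => h.
have {}h : (r * ln 2) ^+ 2 / 2 <= expR (r * ln 2) by lra.
rewrite expRN ler_pdivrMr ?expR_gt0//; apply: le_trans Wr _.
apply: (@le_trans _ _ (c1 / r * ((r * ln 2) ^+ 2 / 2))).
  by rewrite le_eqVlt; apply/orP; left; apply/eqP; rewrite /c1; field; rewrite !gt_eqF.
rewrite ler_wpM2l// divr_ge0 ?(ltW r0)// divr_ge0// sqr_ge0//.
Qed.

(* The window [v - u <= 3 z] covers [b >= r^-3]; for smaller [b], [b^s] is bounded
   by its value at [r^-3], which is already negligible. *)
Lemma Rpb_upper_asymp : 0 < b < 1/2 ->
  Rpb p b * W <= 2 `^ r * ((1 + (5 + c1) / r) * E).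
Proof.
move=> /andP[b0 b12]; have b10 : 0 < 1 - b by lra.
have W0 := half_sqrt_ge0.
have E0 : 0 < E by exact: expR_gt0.
have l20 : 0 < ln 2 :> R by rewrite ln_gt0//; lra.
have c10 : 0 <= c1 by rewrite divr_ge0// sqr_ge0.
have lb0 : ln b <= 0 by apply: ln_le0; lra.
have l10 : ln (1 - b) <= 0 by apply: ln_le0; lra.
have lbb : ln b <= ln (1 - b) by rewrite ler_ln ?posrE//; lra.
have pE (y : R) : 0 < y -> y `^ r = expR (r * ln y) by move=> y0; rewrite /powR gt_eqF.
have split3 : 1 + (5 + c1) / r = (c1 / r + (1 + 1 / r)) + 4 / r by field; rewrite gt_eqF.
have r1 : 1 <= r by apply: le_trans r20; lra.
rewrite RpbE -/r.
have [hb|hb] := leP (- (3 * z)) (ln b).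
  have win : 0 <= ln (1 - b) - ln b <= 3 * z by apply/andP; split; lra.
  have h1 : powsum (1 / r) b `^ r <= 2 `^ r * expR (ln b / 2) * E.
    rewrite /powsum !powR_expR_div//; apply: le_trans (pow_sum_window win) _.
    rewrite ler_pM2r// ler_pM2l ?powR_gt0// ler_expR; lra.
  (* The term [b^r <= 2^(- r)] is negligible. For the other one, [(1 - b)^r sqrt b W] is squared and
     bounded through [(1 - b)^(2 r) <= e^(- 2 r b)], which leaves [p / r = 1 + 1 / r]. *)
  have h2 : powsum r b * (expR (ln b / 2) * W) <= c1 / r + (1 + 1 / r).
    rewrite /powsum !pE// mulrDl; apply: lerD.
      apply: le_trans W2r; rewrite mulrA [leRHS]mulrC ler_wpM2r// -expRD ler_expR.
      have : r * ln b <= r * ln (2^-1).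
        by rewrite ler_pM2l// ler_ln ?posrE//; lra.
      by rewrite lnV ?posrE//; lra.
    apply: ler_of_sqr; first by rewrite addr_ge0// divr_ge0// ltW.
    have e1 : expR (ln b / 2) ^+ 2 = b.
      by rewrite -expRM_natl (_ : 2%:R * (ln b / 2) = ln b) ?lnK//; field.
    rewrite exprMn [X in _ * X]exprMn e1 half_sqrt_sqr ?p0// -expRM_natl.
    have e2 : expR (2%:R * (r * ln (1 - b))) <= expR (- (2 * r * b)).
      rewrite ler_expR; have : ln (1 - b) <= - b by apply: le_ln1Dx; lra.
      by rewrite -(ler_pM2l r0); lra.
    have e3 := sqrt_mul_expRN_le r0 b0.
    have pr : 1 + 1 / r = p / r by rewrite /r; field; rewrite gt_eqF.
    rewrite pr; apply: (@le_trans _ _ (p / r)); last first.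
      rewrite -pr expr2 ler_peMl//; first by rewrite addr_ge0// divr_ge0// ltW.
      by rewrite lerDl divr_ge0// ltW.
    apply: (@le_trans _ _ (expR (- (2 * r * b)) * (b * (2 * expR 1 * p)))).
      by rewrite ler_wpM2r// !mulr_ge0 ?expR_ge0// ltW// p0.
    rewrite ler_pdivlMr// (_ : _ * _ * r = (2 * expR 1 * r * b * expR (- (2 * r * b))) * p); last by ring.
    by rewrite ler_piMl// ltW// p0.
  have P0 : 0 <= powsum r b by rewrite addr_ge0 ?powR_ge0.
  apply: (@le_trans _ _ (powsum r b * (2 `^ r * expR (ln b / 2) * E) * W)).
    by rewrite ler_wpM2r// ler_wpM2l.
  rewrite (_ : _ * _ * W = 2 `^ r * ((powsum r b * (expR (ln b / 2) * W)) * E)); last by ring.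
  rewrite ler_pM2l ?powR_gt0// ler_pM2r//; apply: le_trans h2 _.
  by rewrite split3 lerDl divr_ge0// ltW.
have win : 0 <= 0 - (- (3 * z)) <= 3 * z.
  by rewrite sub0r opprK lexx andbT mulr_ge0// ltW.
have h1 : powsum (1 / r) b `^ r <= 2 `^ r * expR (- (3 * z) / 2) * E.
  have := pow_sum_window win; rewrite addr0; apply: le_trans.
  apply: ge0_ler_powR; rewrite ?nnegrE ?(ltW r0) ?addr_ge0 ?powR_ge0 ?expR_ge0//.
  rewrite /powsum !powR_expR_div//.
  by apply: lerD; rewrite ler_expR ler_pM2r ?invr_gt0// ltW.
have h2 : powsum r b <= 1.
  have hb1 : b `^ r <= b by apply: ge1r_powR => //; apply/andP; split; lra.
  have hc : (1 - b) `^ r <= 1 - b by apply: ge1r_powR => //; apply/andP; split; lra.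
  by have := lerD hb1 hc; rewrite (_ : b + (1 - b) = 1)//; ring.
(* Squared, this is [r^-3 W^2 <= 12 r^-2]. *)
have h3 : expR (- (3 * z) / 2) * W <= 4 / r.
  apply: ler_of_sqr; first by rewrite divr_ge0// ltW.
  rewrite exprMn -expRM_natl (_ : 2%:R * (- (3 * z) / 2) = - (3%:R * z)); last by field.
  rewrite expRN expRM_natl -rE mulrC ler_pdivrMr ?exprn_gt0//.
  apply: le_trans W2 _; rewrite (_ : (4 / r) ^+ 2 * r ^+ 3 = 16 * r); last by field; rewrite gt_eqF.
  by rewrite ler_pM2r//; lra.
have P0 : 0 <= powsum r b by rewrite addr_ge0 ?powR_ge0.
apply: (@le_trans _ _ (1 * (2 `^ r * expR (- (3 * z) / 2) * E) * W)).
  by rewrite ler_wpM2r// ler_pM// powR_ge0.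
rewrite mul1r (_ : _ * W = 2 `^ r * ((expR (- (3 * z) / 2) * W) * E)); last by ring.
rewrite ler_pM2l ?powR_gt0// ler_pM2r//; apply: le_trans h3 _.
rewrite split3 lerDr; apply: addr_ge0; first by rewrite divr_ge0// ltW.
by apply: addr_ge0 => //; rewrite divr_ge0// ltW.
Qed.

(** The point [1 / (2 r)] is where [sqrt b e^(- r b)] is largest, so no constant factor is lost. *)
Lemma Rpb_lower_asymp : 2 `^ r * expR (- (2 * r - 1)^-1) <= Rpb p (2 * r)^-1 * W.
Proof.
have r1 : 1 < r by apply: lt_le_trans r20; lra.
have d0 : 0 < 2 * r by lra.
have d1 : 0 < 2 * r - 1 by lra.
set a := (2 * r)^-1; have a0 : 0 < a by rewrite invr_gt0.
have a1 : a < 1 by rewrite invf_lt1//; lra.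
have a10 : 0 < 1 - a by lra.
have W0 := half_sqrt_ge0.
have pE (y : R) : 0 < y -> y `^ r = expR (r * ln y) by move=> y0; rewrite /powR gt_eqF.
have lv : - (2 * r - 1)^-1 <= ln (1 - a).
  have e : (1 - a)^-1 = 1 + (2 * r - 1)^-1.
    by rewrite /a; field; rewrite !gt_eqF// subr_gt0.
  have := @le_ln1Dx R ((2 * r - 1)^-1); rewrite -e lnV ?posrE//.
  have i0 : 0 < (2 * r - 1)^-1 by rewrite invr_gt0.
  by move=> /(_ _); rewrite lerNl; apply; lra.
have lu : expR (1/2) <= expR (ln a / 2) * W.
  apply: ler_of_sqr; first by rewrite mulr_ge0// expR_ge0.
  rewrite exprMn half_sqrt_sqr ?p0// -!expRM_natl.
  rewrite (_ : 2%:R * (ln a / 2) = ln a); last by field.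
  rewrite (_ : 2%:R * (1/2) = 1); last by field.
  rewrite lnK ?posrE// /a [leRHS](_ : _ = expR 1 * (p / r)); last by field; rewrite gt_eqF.
  by rewrite ler_peMr ?expR_ge0// ler_pdivlMr// mul1r /r; lra.
rewrite RpbE -/r.
apply: (@le_trans _ _ ((1 - a) `^ r * (2 `^ r * expR ((ln a + ln (1 - a)) / 2)) * W)); last first.
  rewrite ler_wpM2r//; apply: ler_pM; rewrite ?mulr_ge0 ?powR_ge0 ?expR_ge0//.
    by rewrite /powsum lerDr powR_ge0.
  by rewrite /powsum !powR_expR_div//; exact: pow_sum_expR_ge.
rewrite (pE _ a10) [(ln a + _) / 2]mulrDl [expR (ln a / 2 + _)]expRD.
rewrite [leRHS](_ : _ = 2 `^ r * (expR (r * ln (1 - a)) * expR (ln (1 - a) / 2) * (expR (ln a / 2) * W))); last by ring.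
rewrite ler_pM2l ?powR_gt0// -expRD.
(* As [(r + 1/2) / (2 r - 1) = 1/2 + 1 / (2 r - 1)], the factor [e^(1/2)] coming from [sqrt a W]
   cancels the leading loss. *)
apply: (@le_trans _ _ (expR (- ((r + 1/2) / (2 * r - 1))) * expR (1/2))).
  rewrite -expRD ler_expR le_eqVlt; apply/orP; left; apply/eqP.
  by field; rewrite gt_eqF.
apply: ler_pM; rewrite ?expR_ge0// ler_expR.
have : (r + 1/2) * - (2 * r - 1)^-1 <= (r + 1/2) * ln (1 - a) by rewrite ler_pM2l//; lra.
by rewrite mulrN mulrDl; lra.
Qed.

End bounds.

Lemma cvg_Cbest_asymp :
  (fun x : R => fine (Cbest x) / (2 `^ x / Num.sqrt (8 * expR 1 * x))) @ +oo --> (1 : R).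
Proof.
pose c := 5 + 8 / ln 2 ^+ 2 : R.
have cr (k : R) : (p - k) @[p --> +oo] --> (+oo : set_system R).
  apply/cvgryPge => A; near=> p; rewrite lerBrDr ltW//.
  by near: p; apply: nbhs_pinfty_gt; rewrite num_real.
have clnr : ln (p - 1) @[p --> +oo] --> (+oo : set_system R).
  apply/cvgryPge => A; near=> p.
  have h : 1 + expR A < p by near: p; apply: nbhs_pinfty_gt; rewrite num_real.
  rewrite -[A]expRK ler_ln ?posrE ?expR_gt0//; first by rewrite lerBrDl ltW.
  by rewrite subr_gt0; apply: lt_trans h; rewrite ltrDl expR_gt0.
have inv0 (f : R -> R) : f p @[p --> +oo] --> (+oo : set_system R) ->
    (f p)^-1 @[p --> +oo] --> (0 : R).
  move=> fy; have fp : \forall p \near +oo, 0 < f p.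
    by move/cvgryPgt : fy => /(_ 0).
  by apply/(gtr0_cvgV0 fp).
have ec (f : R -> R) : f p @[p --> +oo] --> (0 : R) -> expR (f p) @[p --> +oo] --> (1 : R).
  move=> f0; have := continuous_cvg _ (@continuous_expR R 0) f0.
  by rewrite expR0; apply.
apply: (@squeeze_cvgr _ _ _ _ (fun p => expR (- (2 * (p - 1) - 1)^-1))
   (fun p => (1 + c / (p - 1)) * expR (27 / ln (p - 1)))).
- near=> p.
  have p1 : 1 < p by near: p; apply: nbhs_pinfty_gt; rewrite num_real.
  have z5 : 5 <= ln (p - 1) by near: p; move/cvgryPge : clnr => /(_ 5).
  have p0 : 0 < p by apply: lt_trans p1.
  have r2 : 2 < p - 1.
    rewrite ltrBrDr; near: p; apply: nbhs_pinfty_gt; rewrite num_real//.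
  set W := Num.sqrt (8 * expR 1 * p) / 2.
  have t0 : 0 < 2 `^ (p - 1) :> R by rewrite powR_gt0.
  have s0 : 0 < Num.sqrt (8 * expR 1 * p) by rewrite sqrtr_gt0 !mulr_gt0 ?expR_gt0.
  have -> : fine (Cbest p) / (2 `^ p / Num.sqrt (8 * expR 1 * p)) =
      Cmax p * W / 2 `^ (p - 1).
    rewrite -> (fine_Cbest p1); rewrite -(@mulr_powRB1 _ 2)// /W.
    move: (Cmax p) => M; field; rewrite !gt_eqF//.
  apply/andP; split.
    rewrite ler_pdivlMr// [leLHS]mulrC; apply: le_trans (Rpb_lower_asymp z5) _.
    apply: ler_wpM2r; first exact: half_sqrt_ge0.
    apply: Cmax_ge; first exact: p1.
    by rewrite invr_ge0 invf_le1; [apply/andP; split|]; lra.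
  have [b b12 ->] := Cmax_attained p1.
  by rewrite ler_pdivrMr// [leRHS]mulrC; exact: Rpb_upper_asymp z5 b12.
- apply: ec; rewrite -[X in _ --> X]oppr0; apply: cvgN; apply: inv0.
  apply/cvgryPge => A; near=> p.
  have : 2 + `|A| < p by near: p; apply: nbhs_pinfty_gt; rewrite num_real.
  by have := ler_norm A; have := normr_ge0 A; lra.
- rewrite -[X in _ --> X]mulr1; apply: cvgM.
    rewrite -[X in _ --> X]addr0; apply: cvgD; first exact: cvg_cst.
    rewrite -(mulr0 c); apply: cvgM; first exact: cvg_cst.
    exact: inv0.
  apply: ec; rewrite -(mulr0 27); apply: cvgM; first exact: cvg_cst.
  exact: inv0.
Unshelve. all: by end_near. Qed.

End asymptotics.

(** * Rational exponents *)

Section algebraicity.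
Variable R : realType.
Implicit Types x p b : R.

Local Notation alg := (algebraicOver (ratr : rat -> R)).

Lemma algebraic_numP x : algebraic_num x <-> alg x.
Proof. by split=> [[Q [Q0 Qx]]|[Q Q0 Qx]]; exists Q. Qed.

Lemma algebraic_root x n : (0 < n)%N -> alg (x ^+ n) -> alg x.
Proof.
move=> n0 [Q Q0 Qx]; exists (Q \Po 'X^n).
  by rewrite comp_poly_eq0// size_polyXn.
by rewrite map_comp_poly map_polyXn /root horner_comp hornerXn.
Qed.

Lemma algebraic_exp x n : alg x -> alg (x ^+ n).
Proof.
by move=> ax; elim: n => [|n IH]; [rewrite expr0; exact: algebraic1|rewrite exprS; exact: algebraic_mul].
Qed.

Lemma algebraic_powR x (m n : nat) : 0 < x -> (0 < n)%N -> alg x -> alg (x `^ (m%:R / n%:R)).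
Proof.
move=> x0 n0 ax; apply: (@algebraic_root _ n n0).
rewrite -powR_mulrn ?powR_ge0// -powRrM divfK ?pnatr_eq0 -?lt0n//.
by rewrite powR_mulrn ?(ltW x0)//; exact: algebraic_exp.
Qed.

Lemma ratr_pos_frac p : 1 < p -> (exists q : rat, p = ratr q) ->
  exists m n : nat, [/\ (0 < m)%N, (0 < n)%N & p - 1 = m%:R / n%:R].
Proof.
move=> p1 [q pE]; have q1 : 0 < q - 1.
  by rewrite subr_gt0 -(ltr_rat R) rmorph1 -pE.
have nq : 0 < numq (q - 1) by rewrite numq_gt0.
exists `|numq (q - 1)|%N, `|denq (q - 1)|%N; split.
- by rewrite absz_gt0 gt_eqF.
- by rewrite absz_gt0 denq_neq0.
rewrite !natr_absz !gtr0_norm ?denq_gt0//.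
have -> : p - 1 = ratr (q - 1) by rewrite rmorphB rmorph1 pE.
by have := congr1 (@ratr R) (divq_num_den (q - 1)); rewrite fmorph_div !rmorph_int.
Qed.

(** With [r = m / n] and [z = e^(y / (m n))], the exponentials of [y], [r y] and [y / r] are powers
    of [z]; clearing denominators in the critical equation gives [Q]. *)
Lemma algebraic_critical (m n : nat) (z : R) : (0 < m)%N -> (0 < n)%N -> m != n ->
  0 < z ->
  (1 + z ^+ (m * n))^-1 - m%:R / n%:R * (1 + z ^+ (m * m))^-1 =
  (1 + z ^+ (n * n))^-1 - m%:R / n%:R * (1 + z ^+ (m * n))^-1 -> alg z.
Proof.
move=> m0 n0 mn z0 E.
pose Q : {poly rat} := m%:R *: 'X^(m * m) + n%:R *: 'X^(n * n) +
   (m%:R + n%:R) *: 'X^(m * m + n * n) - (m%:R + n%:R) *: 'X^(m * n)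
   - m%:R *: 'X^(m * n + n * n) - n%:R *: 'X^(m * n + m * m).
exists Q.
  (* [Q] is nonzero because the smaller of [m^2] and [n^2] is strictly below every other exponent,
     so its coefficient survives. *)
  have [lmn|lnm|] := ltngtP m n; last by move/eqP: mn.
    apply/eqP => /polyP /(_ (m * m)%N); rewrite coef0 /Q !coefE.
    rewrite eqxx (_ : (m * m == n * n)%N = false); last by apply/eqP; nia.
    rewrite (_ : (m * m == m * m + n * n)%N = false); last by apply/eqP; nia.
    rewrite (_ : (m * m == m * n)%N = false); last by apply/eqP; nia.
    rewrite (_ : (m * m == m * n + n * n)%N = false); last by apply/eqP; nia.
    rewrite (_ : (m * m == m * n + m * m)%N = false); last by apply/eqP; nia.
    by rewrite !(mulr0, subr0, addr0, mulr1) => /eqP; rewrite pnatr_eq0 => /eqP; lia.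
  apply/eqP => /polyP /(_ (n * n)%N); rewrite coef0 /Q !coefE.
  rewrite eqxx (_ : (n * n == m * m)%N = false); last by apply/eqP; nia.
  rewrite (_ : (n * n == m * m + n * n)%N = false); last by apply/eqP; nia.
  rewrite (_ : (n * n == m * n)%N = false); last by apply/eqP; nia.
  rewrite (_ : (n * n == m * n + n * n)%N = false); last by apply/eqP; nia.
  rewrite (_ : (n * n == m * n + m * m)%N = false); last by apply/eqP; nia.
  by rewrite !(mulr0, subr0, addr0, add0r, mulr1) => /eqP; rewrite pnatr_eq0 => /eqP; lia.
rewrite /root /Q !(rmorphB, rmorphD)/= !map_polyZ/= !map_polyXn.
rewrite !rmorphD/= !ratr_nat !hornerE ?hornerXn !exprD.
have zm k : 0 < 1 + z ^+ k by rewrite addr_gt0// exprn_gt0.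
have := zm (m * n)%N; have := zm (m * m)%N; have := zm (n * n)%N.
move: E; set D := z ^+ (m * n); set A := z ^+ (m * m); set B := z ^+ (n * n).
have nR : n%:R != 0 :> R by rewrite pnatr_eq0 -lt0n.
move=> E B0 A0 D0.
have An := lt0r_neq0 A0; have Bn := lt0r_neq0 B0; have Dn := lt0r_neq0 D0.
apply/eqP; rewrite [LHS](_ : _ = (((1 + D)^-1 - m%:R / n%:R * (1 + A)^-1) -
  ((1 + B)^-1 - m%:R / n%:R * (1 + D)^-1)) * (n%:R * (1 + A) * (1 + B) * (1 + D))).
  by rewrite E subrr mul0r.
by field; rewrite nR An Bn Dn.
Qed.

Lemma algebraic_Rpb p b (m n : nat) : (0 < m)%N -> (0 < n)%N -> p - 1 = m%:R / n%:R ->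
  0 < b < 1 -> alg b -> alg (Rpb p b) /\ alg (tb p b).
Proof.
move=> m0 n0 rE /andP[b0 b1] ab.
have ab1 : alg (1 - b) by apply: algebraic_sub => //; exact: algebraic1.
have b10 : 0 < 1 - b by rewrite subr_gt0.
have sE : 1 / (p - 1) = n%:R / m%:R by rewrite rE div1r invf_div.
have e1 c : 0 < c -> alg c -> alg (c `^ (p - 1)) by move=> c0 ac; rewrite rE; exact: algebraic_powR.
have e2 c : 0 < c -> alg c -> alg (c `^ (1 / (p - 1))) by move=> c0 ac; rewrite sE; exact: algebraic_powR.
have aS : alg (b `^ (1 / (p - 1)) + (1 - b) `^ (1 / (p - 1))).
  by apply: algebraic_add; exact: e2.
split.
  apply: algebraic_mul; first by apply: algebraic_add; exact: e1.
  by apply: e1 => //; rewrite addr_gt0// powR_gt0.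
apply: algebraic_sub => //; apply: algebraic_div => //; exact: e2.
Qed.

Lemma algebraic_bp p : 1 < p -> p != 2 -> (exists q : rat, p = ratr q) ->
  exists m n : nat, [/\ (0 < m)%N, (0 < n)%N, p - 1 = m%:R / n%:R & alg (bp p)].
Proof.
move=> p1 p2 /(ratr_pos_frac p1)[m [n [m0 n0 rE]]]; exists m, n; split=> //.
have nm : (0 : R) < m%:R by rewrite ltr0n.
have nn : (0 : R) < n%:R by rewrite ltr0n.
have mn : m != n.
  apply: contra_neq p2 => mn; move: rE; rewrite mn divff ?gt_eqF// => h; lra.
have hm := bp_max p1; have bI := is_Rpb_max_interior p1 p2 hm.
have := Rpb_max_critical p1 bI hm.2 => /=.
set y := ln _ => E.
have [b0 b1] : 0 < bp p /\ bp p < 1 by clear - bI; case/andP: bI => ? ?; split; lra.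
have b10 : 0 < 1 - bp p by rewrite subr_gt0.
pose z := expR (y / (m%:R * n%:R)).
have zX k t : t = k%:R / (m%:R * n%:R) * y -> expR t = z ^+ k.
  by move=> ->; rewrite -expRM_natl; congr expR; field; rewrite !gt_eqF.
have az : alg z.
  apply: (@algebraic_critical m n) => //; first exact: expR_gt0.
  move: E; rewrite /logistic_gap rE.
  rewrite (zX (m * n)%N y); last by rewrite natrM divff ?mul1r// mulf_neq0// gt_eqF.
  rewrite (zX (m * m)%N (m%:R / n%:R * y)); last by rewrite natrM; field; rewrite !gt_eqF.
  rewrite (zX (n * n)%N (y / (m%:R / n%:R))); last by rewrite natrM; field; rewrite !gt_eqF.
  by rewrite (zX (m * n)%N (m%:R / n%:R * (y / (m%:R / n%:R))))// natrM; field; rewrite !gt_eqF.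
have -> : bp p = (1 + z ^+ (m * n))^-1.
  rewrite -(zX _ y); last by rewrite natrM divff ?mul1r// mulf_neq0// gt_eqF.
  rewrite /y lnK ?posrE ?divr_gt0//.
  by rewrite (_ : 1 + _ = (bp p)^-1) ?invrK//; field; rewrite gt_eqF.
apply: algebraic_inv; apply: algebraic_add; first exact: algebraic1.
exact: algebraic_exp.
Qed.

End algebraicity.

(** * Closed forms for [p = 3] *)

Section p3.
Variable R : realType.
Let q : R := Num.sqrt 7.
Let q2 : q ^+ 2 = 7. Proof. by rewrite sqr_sqrtr. Qed.
Let q0 : 0 <= q. Proof. exact: sqrtr_ge0. Qed.
Let qlo : 5/2 < q.
Proof. by rewrite -(@ltr_pXn2r _ 2) ?nnegrE// ?q2; lra. Qed.
Let qhi : q < 3.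
Proof. by rewrite -(@ltr_pXn2r _ 2) ?nnegrE// ?q2; lra. Qed.
Let w : R := Num.sqrt (1 + 2 * q).
Let w2 : w ^+ 2 = 1 + 2 * q. Proof. by rewrite sqr_sqrtr//; have := q0; lra. Qed.
Let w0 : 0 <= w. Proof. exact: sqrtr_ge0. Qed.
Let w3 : w < 3.
Proof. by rewrite -(@ltr_pXn2r _ 2) ?nnegrE// ?w2; have := qhi; lra. Qed.
Let wpos : 0 < w.
Proof. by rewrite sqrtr_gt0; have := q0; lra. Qed.
Let b3 : R := 1/2 - 1/6 * w.
(** In [s = sqrt (b (1 - b))] the function is the cubic [(1 - 2 s^2) (1 + 2 s)]; [s3] is its
    positive critical point, the root of [6 s^2 + 2 s = 1]. *)
Let s3 : R := (q - 1) / 6.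

Lemma Rpb3 (b : R) : 0 <= b <= 1 ->
  Rpb 3 b = (1 - 2 * Num.sqrt (b * (1 - b)) ^+ 2) * (1 + 2 * Num.sqrt (b * (1 - b))).
Proof.
move=> /andP[b0 b1]; have b10 : 0 <= 1 - b by rewrite subr_ge0.
rewrite /Rpb (_ : 3 - 1 = 2%:R); last by lra.
have s0 : 0 <= b `^ (1 / 2%:R) + (1 - b) `^ (1 / 2%:R) by rewrite addr_ge0 ?powR_ge0.
rewrite (powR_mulrn 2 b0) (powR_mulrn 2 b10) (powR_mulrn 2 s0) div1r.
rewrite (powR12_sqrt b0) (powR12_sqrt b10) (sqrtrM _ b0).
have x2 := sqr_sqrtr b0; have y2 := sqr_sqrtr b10.
move: x2 y2; set x := Num.sqrt b; set y := Num.sqrt (1 - b) => x2 y2.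
have xy : x ^+ 2 + y ^+ 2 = 1 by rewrite x2 y2; ring.
rewrite (_ : b ^+ 2 + (1 - b) ^+ 2 = 1 - 2 * (b * (1 - b))); last by ring.
rewrite -y2 -x2 -exprMn; congr (_ * _).
by transitivity (x ^+ 2 + y ^+ 2 + 2 * (x * y)); [ring|rewrite xy].
Qed.

Lemma b3_bnd : 0 <= b3 <= 1/2.
Proof. by have := w0; have := w3; rewrite /b3 => ? ?; apply/andP; split; lra. Qed.

Lemma sqrt_b3 : Num.sqrt (b3 * (1 - b3)) = s3.
Proof.
have -> : b3 * (1 - b3) = s3 ^+ 2.
  rewrite /b3 /s3; have e : (1/2 - 1/6 * w) * (1 - (1/2 - 1/6 * w)) = 1/4 - w ^+ 2 / 36 by field.
  by rewrite e w2 exprMn sqrrB q2; field.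
by rewrite sqrtr_sqr ger0_norm// /s3; have := qlo; lra.
Qed.

Lemma s3_eq : s3 ^+ 2 = (1 - 2 * s3) / 6.
Proof. by rewrite /s3 exprMn sqrrB q2; field. Qed.

Lemma Rpb3_b3 : Rpb 3 b3 = (17 + 7 * q) / 27.
Proof.
rewrite Rpb3; last by have := b3_bnd => /andP[? ?]; apply/andP; split; lra.
rewrite sqrt_b3 s3_eq /s3.
rewrite [LHS](_ : _ = (10 + 7 * q + q ^+ 2) / 27); last by field.
by rewrite q2; field.
Qed.

Lemma b3_max : is_Rpb_max 3 b3.
Proof.
split=> [|b /andP[b0 b1]]; first exact: b3_bnd.
have hb : 0 <= b <= 1 by apply/andP; split; lra.
have hb3 : 0 <= b3 <= 1 by have := b3_bnd => /andP[? ?]; apply/andP; split; lra.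
rewrite (Rpb3 hb) (Rpb3 hb3) sqrt_b3; set s := Num.sqrt _; have s0 : 0 <= s by exact: sqrtr_ge0.
rewrite -subr_ge0.
(* The difference of cubic values has a double root at [s3], up to a multiple of the critical
   equation; this gives a global maximum over [s >= 0] directly. *)
have -> : (1 - 2 * s3 ^+ 2) * (1 + 2 * s3) - (1 - 2 * s ^+ 2) * (1 + 2 * s) =
   4 * (s - s3) ^+ 2 * (s + (1/2 + 2 * s3)) +
   (s - s3) * 2 * (6 * (s3 ^+ 2 - (1 - 2 * s3) / 6)).
  by field.
rewrite s3_eq subrr !mulr0 addr0; apply: mulr_ge0.
  by apply: mulr_ge0 => //; exact: sqr_ge0.
by apply: addr_ge0 => //; rewrite /s3; have := qlo; lra.
Qed.

Lemma bp3 : bp (3 : R) = 1/2 - 1/6 * Num.sqrt (1 + 2 * Num.sqrt 7).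
Proof.
have p1 : 1 < 3 :> R by lra.
have p2 : 3 != 2 :> R by rewrite gt_eqF//; lra.
exact: (is_Rpb_max_uniq p1 p2 (bp_max p1) b3_max).
Qed.

Lemma Cmax3 : Cmax (3 : R) = (17 + 7 * Num.sqrt 7) / 27.
Proof. by rewrite /Cmax bp3 -/q -/w -/b3 Rpb3_b3. Qed.

Lemma tb3 : tb (3 : R) (bp 3) = - (1/3) * Num.sqrt ((13 * Num.sqrt 7 - 34) / 2).
Proof.
rewrite bp3 -/q -/w -/b3.
have [b0 b1] : 0 < b3 /\ b3 < 1/2 by have := w3; have := wpos; rewrite /b3 => ? ?; split; lra.
have b10 : 0 < 1 - b3 by lra.
rewrite /tb (_ : 1 / (3 - 1) = 2^-1); last by field.
rewrite !powR12_sqrt ?(ltW b0) ?(ltW b10)//.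
set x := Num.sqrt b3; set y := Num.sqrt (1 - b3).
have x2 : x ^+ 2 = b3 by rewrite sqr_sqrtr// ltW.
have y2 : y ^+ 2 = 1 - b3 by rewrite sqr_sqrtr// ltW.
have x2y2 : x ^+ 2 + y ^+ 2 = 1 by rewrite x2 y2; ring.
have xy : x * y = s3 by rewrite -sqrtrM ?(ltW b0)// sqrt_b3.
have x0 : 0 < x by rewrite sqrtr_gt0.
have y0 : 0 < y by rewrite sqrtr_gt0.
have xley : x <= y by rewrite ler_sqrt ?(ltW b10)//; lra.
have xyp : x + y != 0 by rewrite gt_eqF// addr_gt0.
have tE : b3 - x / (x + y) = - (s3 * ((y - x) / (x + y))).
  rewrite -xy; transitivity (x ^+ 2 - x * (x ^+ 2 + y ^+ 2) / (x + y)).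
    by rewrite x2y2 mulr1 x2.
  by field.
rewrite tE mulNr; congr (- _).
have s30 : 0 <= s3 by rewrite /s3; have := qlo; lra.
(* With [x^2 + y^2 = 1] and [x y = s3], the squares of [y - x] and [x + y] are [1 - 2 s3] and
   [1 + 2 s3], so the square of [tb] involves [s3] alone; [s3_eq] then lowers the degree. *)
have -> : (13 * q - 34) / 2 = (3 * (s3 * ((y - x) / (x + y)))) ^+ 2.
  rewrite [RHS](_ : _ = 3 ^+ 2 * (s3 ^+ 2 * ((y - x) ^+ 2 / (x + y) ^+ 2))); last by field.
  have -> : (y - x) ^+ 2 = 1 - 2 * s3 by rewrite sqrrB x2 y2 -xy; ring.
  have -> : (x + y) ^+ 2 = 1 + 2 * s3 by rewrite sqrrD x2 y2 xy; ring.
  have d0 : 1 + 2 * s3 != 0 by rewrite gt_eqF//; lra.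
  apply: (mulIf d0); rewrite s3_eq.
  have -> : 3 ^+ 2 * ((1 - 2 * s3) / 6 * ((1 - 2 * s3) / (1 + 2 * s3))) * (1 + 2 * s3)
     = 3 / 2 * (1 - 2 * s3) ^+ 2 by field.
  rewrite /s3.
  transitivity ((13 * q ^+ 2 - 8 * q - 68) / 6); first by field.
  transitivity ((16 - 8 * q + q ^+ 2) / 6); last by field.
  by rewrite q2; field.
rewrite sqrtr_sqr ger0_norm; first by field.
apply: mulr_ge0 => //; apply: mulr_ge0 => //; apply: divr_ge0; first by rewrite subr_ge0.
by rewrite addr_ge0// ltW.
Qed.

End p3.

Unset Implicit Arguments.

Theorem theorem2p3 (R : realType) :
  (forall p : R, 1 < p ->
    (* (i) *)
    [/\ Cbest p = ereal_sup [set (Rpb p b)%:E | b in `[0, 1]],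
        (exists2 b, 0 < b < 1/2 &
           Cbest p = (Rpb p b)%:E /\ forall b', 0 < b' < 1/2 -> Rpb p b' <= Rpb p b),
        (p != 2 -> Cbest p = (Rpb p (bp p))%:E) &
        (forall (d : measure_display) (T : measurableType d)
                (P : probability T R) (X : {RV P >-> R}),
           P.-integrable setT (EFin \o X) ->
           (\int[P]_x (`| X x - fine 'E_P[X] | `^ p)%:E
              <= Cbest p * \int[P]_x (`| X x | `^ p)%:E)%E)]
    (* (ii) *)
    /\ (forall (d : measure_display) (T : measurableType d)
               (P : probability T R) (X : {RV P >-> R}),
          P.-integrable setT (EFin \o X) ->
          ((\int[P]_x (`| X x - fine 'E_P[X] | `^ p)%:E
              = Cbest p * \int[P]_x (`| X x | `^ p)%:E)%E
           <->
           [\/ (\int[P]_x (`| X x | `^ p)%:E = +oo)%E,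
               [/\ p = 2, (\int[P]_x ((X x) ^+ 2)%:E < +oo)%E & ('E_P[X] = 0)%E] |
               p != 2 /\ exists lam : R,
                 same_law_scaled_twopoint X (1 - bp p) (bp p) lam (tb p (bp p))]))
    (* (iii) *)
    /\ (let q := p / (p - 1) in
        fine (Cbest p) `^ (1 / Num.sqrt (p - 1))
          = fine (Cbest q) `^ (1 / Num.sqrt (q - 1))
        /\ (p != 2 -> bp p = bp q))
    (* (vi), general part *)
    /\ ((exists r : rat, p = ratr r) ->
        algebraic_num (fine (Cbest p))
        /\ (p != 2 -> algebraic_num (bp p) /\ algebraic_num (tb p (bp p)))))
  (* (i), the case p = 2 *)
  /\ (Cbest (2:R) = 1%:E /\ forall b : R, 0 <= b <= 1 -> Rpb 2 b = 1)
  (* (iv) *)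
  /\ ((fun x : R => fine (Cbest x) / (2 `^ x / Num.sqrt (8 * expR 1 * x))) @ +oo --> (1 : R))
  (* (v) *)
  /\ [/\ (forall x y t : R, 1 < x -> 1 < y -> x != y -> 0 < t < 1 ->
            ln (fine (Cbest (t * x + (1 - t) * y)))
              < t * ln (fine (Cbest x)) + (1 - t) * ln (fine (Cbest y))),
         {in `]1, +oo[, continuous (fun x : R => fine (Cbest x))},
         (forall x y : R, 1 < x -> x < y -> y <= 2 -> fine (Cbest y) < fine (Cbest x)),
         (forall x y : R, 2 <= x -> x < y -> fine (Cbest x) < fine (Cbest y)) &
         ((fun x : R => fine (Cbest x)) @ 1^'+ --> (2 : R)) /\ ((fun x : R => fine (Cbest x)) @ +oo --> +oo)]
  (* (vi), p = 3 *)
  /\ [/\ Cbest (3:R) = ((17 + 7 * Num.sqrt 7) / 27)%:E,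
         bp (3:R) = 1/2 - 1/6 * Num.sqrt (1 + 2 * Num.sqrt 7) &
         tb (3:R) (bp 3) = - (1/3) * Num.sqrt ((13 * Num.sqrt 7 - 34) / 2)].
Proof.
split=> [p p1|].
  have CE := CbestE p1.
  split; [|split; [|split]].
  - split.
    + rewrite -> CE; apply/le_anti/andP; split.
        apply: ereal_sup_ubound; exists (bp p) => //=.
        by rewrite in_itv/=; exact: bp_bnd.
      apply: ge_ereal_sup => _ [b b01 <-]; rewrite lee_fin; exact: Cmax_ge.
    + have [b b12 bE] := Cmax_attained p1; exists b; first exact: b12.
      split; first by rewrite -> CE; congr EFin; exact: bE.
      move=> c /andP[c0 c1]; rewrite <- bE; apply: Cmax_ge; first exact: p1.
      by apply/andP; split; lra.
    + by move=> _; exact: CE.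
    + by move=> d T P X iX; rewrite -> CE; exact: centering_inequality.
  - by move=> d T P X iX; rewrite -> CE; exact: centering_equality.
  - move=> q; have q1 : 1 < q by exact: conj_gt1.
    split; last by move=> _; exact (esym (bp_conj p1)).
    rewrite -> (fine_Cbest p1), (fine_Cbest q1); exact: Cmax_conj_sqrt.
  - move=> prat; rewrite -> (fine_Cbest p1).
    have [p2|p2] := eqVneq p 2.
      split; last by [].
      apply/algebraic_numP; have -> : Cmax p = 1 by rewrite p2; exact: Cmax2.
      exact: algebraic1.
    have [m [n [m0 n0 rE ab]]] := algebraic_bp p1 p2 prat.
    have b01 : 0 < bp p < 1.
      have := is_Rpb_max_interior p1 p2 (bp_max p1); clear => /andP[? ?].
      by apply/andP; split; lra.
    have [aR aT] := algebraic_Rpb m0 n0 rE b01 ab.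
    split; first exact/algebraic_numP.
    by move=> _; split; exact/algebraic_numP.
have fC := @fine_Cbest R.
split; [|split; [|split]].
- split; last exact: Rpb2.
  have two1 : 1 < 2 :> R by lra.
  have -> := CbestE two1; congr EFin; exact: Cmax2.
- exact: cvg_Cbest_asymp.
- split.
  + move=> x y t x1 y1 xy t01; case/andP: (t01) => t0 t1.
    have z1 : 1 < t * x + (1 - t) * y.
      rewrite [X in X < _](_ : _ = t * 1 + (1 - t) * 1); last by ring.
      by rewrite ltrD// ltr_pM2l// subr_gt0.
    by rewrite -> (fC _ x1), (fC _ y1), (fC _ z1); exact: ltr_ln_Cmax.
  + by move=> x; rewrite in_itv/= andbT; exact: continuous_fine_Cbest.
  + move=> x y x1 xy y2; rewrite -> (fC _ x1), (fC _ (lt_trans x1 xy)).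
    exact: Cmax_decr.
  + move=> x y x2 xy; have x1 : 1 < x by lra.
    rewrite -> (fC _ x1), (fC _ (lt_trans x1 xy)); exact: Cmax_incr.
  + split.
      apply: cvg_trans (@cvg_Cmax_1 R); apply: near_eq_cvg; near=> p.
      have p1 : 1 < p by near: p; exact: nbhs_right_gt.
      exact (esym (fC p p1)).
    apply: cvg_trans (@cvg_Cmax_pinfty R); apply: near_eq_cvg; near=> p.
    have p1 : 1 < p by near: p; apply: nbhs_pinfty_gt; rewrite num_real.
    exact (esym (fC p p1)).
- have three1 : 1 < 3 :> R by lra.
  split; [|exact: bp3|exact: tb3].
  have -> := CbestE three1; congr EFin; exact: Cmax3.
Unshelve. all: by end_near. Qed.
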